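(* Let $\omega\in\mathcal W$ and let $f$ be an element of $\mathcal G^{(\omega)}(\mathbb R^n)$ (resp. of $\mathcal G^{\{\omega\}}(\mathbb R^n)$). If for every $x\in\mathbb R^n$ $$f(\cdot+x)-f(\cdot)=0$$ in $\mathcal G^{(\omega)}(\mathbb R^n)$ (resp. in $\mathcal G^{\{\omega\}}(\mathbb R^n)$), i.e. $f$ is invariant by translations, then $f$ is equal to a generalized Beurling constant, i.e. to the class of a net of constant functions defined by an element of $\tilde{\mathbb C}^{(\omega)}$ (resp. to a generalized Roumieu constant, i.e. an element of $\tilde{\mathbb C}^{\{\omega\}}$).
   Context: $\mathbb R^+=[0,\infty)$. $\mathcal W$ is the set of all nondecreasing continuous functions $\omega:\mathbb R^+\to\mathbb R^+$ such that $\omega(0)=0$; $\omega(x+y)\le\omega(x)+\omega(y)$ for all $x,y\ge 0$; $\int_1^\infty \frac{\omega(t)}{t^2}\,dt<\infty$; and $\lim_{t\to\infty}\frac{\omega(t)}{\log(1+t)}=\infty$. Let $\Omega=\mathbb R^n$. For a compactly supported continuous $f$ on $\mathbb R^n$ and $l>0$: $\|f\|_l^{\omega}=\int|\hat f(\xi)|e^{l\omega(|\xi|)}d\xi\in[0,\infty]$. $\mathcal D^{(\omega)}(\Omega)$ (resp. $\mathcal D^{\{\omega\}}(\Omega)$) is the set of continuous $f$ with compact support in $\Omega$ and $\|f\|_l^\omega<\infty$ for all $l>0$ (resp. for some $l>0$). With $*$ standing for $(\omega)$ or $\{\omega\}$, $\mathcal E^{*}(\Omega)$ is the set of smooth $f:\Omega\to\mathbb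 C$ with $\psi f\in\mathcal D^{*}(\Omega)$ for all $\psi\in\mathcal D^{*}(\Omega)$, and for compact $K\subset\Omega$, $\|f\|_{K,l}^{\omega}=\inf\{\|\psi f\|_l^{\omega}:\psi\in\mathcal D^{*}(\Omega),\ \psi=1\text{ on }K\}$. Nets are indexed by $\varepsilon\in(0,1)$, $o(\cdot)$ is as $\varepsilon\to0^+$, $K$ ranges over compact subsets of $\Omega$. Beurling, nets in $\mathcal E^{(\omega)}(\Omega)$: moderate iff $\forall K\,\forall h>0\,\exists k>0$: $\|g_\varepsilon\|_{K,h}^\omega=o(e^{k\omega(1/\varepsilon)})$; negligible iff $\forall K\,\forall h>0\,\forall k>0$: $\|g_\varepsilon\|_{K,h}^\omega=o(e^{-k\omega(1/\varepsilon)})$. Roumieu, nets in $\mathcal E^{\{\omega\}}(\Omega)$: moderate iff $\forall K\,\forall k>0\,\exists h>0$: $\|g_\varepsilon\|_{K,h}^\omega=o(e^{k\omega(1/\varepsilon)})$; negligible iff $\forall K\,\exists k>0\,\exists h>0$: $\|g_\varepsilon\|_{K,h}^\omega=o(e^{-k\omega(1/\varepsilon)})$. $\mathcal G^{(\omega)}(\Omega)$, $\mathcal G^{\{\omega\}}(\Omega)$ are the corresponding quotients of moderate by negligible nets; $f(\cdot+x)$ is the class of $(f_\varepsilon(\cdot+x))$. $\tilde{\mathbb C}^{(\omega)}$: nets of complex numbers that are $o(e^{m\omega(1/\varepsilon)})$ for some $m>0$, modulo those that are $o(e^{-m\omega(1/\varepsilon)})$ for all $m>0$. $\tilde{\mathbb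 C}^{\{\omega\}}$: nets that are $o(e^{m\omega(1/\varepsilon)})$ for all $m>0$, modulo those that are $o(e^{-m\omega(1/\varepsilon)})$ for some $m>0$. *)

(* Defs.v *)
From HB Require Import structures.
From mathcomp Require Import all_boot all_order all_algebra.
From mathcomp Require Import all_classical all_reals all_analysis.
From mathcomp Require Import complex.

Set Implicit Arguments.
Unset Strict Implicit.
Unset Printing Implicit Defensive.

Import Order.TTheory GRing.Theory Num.Theory.
Import numFieldNormedType.Exports ComplexField.Normc.

Local Open Scope classical_set_scope.
Local Open Scope ring_scope.
Local Open Scope complex_scope.

(* MathComp-Analysis has Lebesgue measure on R and binary products only.
   On n-tuples it is built by recursion: a Dirac mass for n = 0, then the image
   of the product measure on R * R^n under (x, t) |-> x :: t. *)
Section lebesgue_tuple.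
Context {R : realType}.
Local Notation mR := (measurableTypeR R).

Definition tuple_cons n (p : mR * n.-tuple mR) : n.+1.-tuple mR :=
  [tuple of p.1 :: p.2].

Lemma measurable_tuple_cons n : measurable_fun setT (@tuple_cons n).
Proof. exact: measurable_cons. Qed.

Section step.
Variables (n : nat) (mu : {sigma_finite_measure set (n.-tuple mR) -> \bar R}).

Definition lebesgue_step : set (n.+1.-tuple mR) -> \bar R :=
  pushforward (@lebesgue_measure R \x mu)%E (@tuple_cons n).

Let step0 : lebesgue_step set0 = 0%E.
Proof. by rewrite /lebesgue_step /pushforward preimage_set0 measure0. Qed.

Let step_ge0 A : (0 <= lebesgue_step A)%E.
Proof. by rewrite /lebesgue_step /pushforward; exact: measure_ge0. Qed.

Let step_sigma_additive : semi_sigma_additive lebesgue_step.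
Proof.
move=> F mF tF mUF; rewrite /lebesgue_step /pushforward preimage_bigcup.
have mp A : measurable A -> measurable (@tuple_cons n @^-1` A).
  by move=> mA; rewrite -[X in measurable X]setTI; exact: measurable_tuple_cons.
apply: measure_semi_sigma_additive.
- by move=> k; exact: mp.
- apply/trivIsetP => /= i j _ _ ij; rewrite -preimage_setI.
  by move/trivIsetP : tF => /(_ _ _ _ _ ij) ->//; rewrite preimage_set0.
- by rewrite -preimage_bigcup; exact: mp.
Qed.

HB.instance Definition _ := isMeasure.Build _ _ _ lebesgue_step
  step0 step_ge0 step_sigma_additive.

Let step_sigma_finite : sigma_finite setT lebesgue_step.
Proof.
have /sigma_finiteP[F [TF ndF mF]] := sigma_finiteT (@lebesgue_measure R).
have /sigma_finiteP[G [TG ndG mG]] := sigma_finiteT mu.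
pose u (t : n.+1.-tuple mR) : mR * n.-tuple mR := (thead t, [tuple of behead t]).
have uK p : u (tuple_cons p) = p.
  by case: p => x t; congr pair; apply/val_inj.
have um : measurable_fun setT u.
  by apply/measurable_fun_pair; [exact: measurable_tnth|exact: measurable_behead].
have mFG i : measurable (F i `*` G i).
  by apply: measurableX; [exact: (mF i).1|exact: (mG i).1].
exists (fun i => u @^-1` (F i `*` G i)) => [|i].
  apply/esym; rewrite -subTset => t _.
  have [k _ Fk] : (\bigcup_k F k) (u t).1 by rewrite -TF.
  have [l _ Gl] : (\bigcup_l G l) (u t).2 by rewrite -TG.
  exists (maxn k l) => //; split.
  - by move: Fk; exact/subsetPset/ndF/leq_maxl.
  - by move: Gl; exact/subsetPset/ndG/leq_maxr.
split; first by rewrite -[X in measurable X]setTI; exact: um.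
rewrite /lebesgue_step /pushforward.
have -> : @tuple_cons n @^-1` (u @^-1` (F i `*` G i)) = F i `*` G i.
  by rewrite -comp_preimage (_ : u \o _ = id) ?preimage_id//; apply/funext.
have [? ?] := mF i; have [? ?] := mG i.
by rewrite product_measure1E// lte_mul_pinfty// ge0_fin_numE.
Qed.

HB.instance Definition _ := Measure_isSigmaFinite.Build _ _ _ lebesgue_step
  step_sigma_finite.

End step.

Fixpoint lebesgue_tuple n : {sigma_finite_measure set (n.-tuple mR) -> \bar R} :=
  match n with
  | 0 => \d_([tuple] : 0.-tuple mR)
  | n'.+1 => lebesgue_step (lebesgue_tuple n')
  end.

Lemma lebesgue_tuple_box n (A : 'I_n -> set mR) :
  (forall i, measurable (A i)) ->
  lebesgue_tuple n [set t | forall i, A i (tnth t i)] =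
  (\prod_(i < n) lebesgue_measure (A i))%E.
Proof.
elim: n A => [|n IHn] A mA.
  by rewrite big_ord0 /= diracE mem_set// => -[].
have mB : measurable [set t : n.-tuple mR | forall i, A (lift ord0 i) (tnth t i)].
  rewrite (_ : [set t | _] = \big[setI/setT]_(i < n)
      ((fun t : n.-tuple mR => tnth t i) @^-1` A (lift ord0 i))).
    apply: bigsetI_measurable => i _.
    by rewrite -[X in measurable X]setTI; exact: measurable_tnth.
  rewrite -bigcap_seq; apply/seteqP; split => t /= tA i => [_|]; first exact: tA.
  by apply: tA => /=; rewrite mem_index_enum.
rewrite big_ord_recl -IHn// -product_measure1E//=.
rewrite /lebesgue_step /pushforward; congr (_ _).
apply/seteqP; split => -[x t] /= => [tA|[Ax At] i].
  split; first by have := tA ord0; rewrite tnth0.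
  by move=> i; have := tA (lift ord0 i); rewrite tnthS.
by case: (unliftP ord0 i) => [j|] ->; rewrite ?tnthS// tnth0.
Qed.

End lebesgue_tuple.

Section ultradistributions.
Context {R : realType}.

(* w stands for a function R+ -> R+: its values on negative reals are
   irrelevant. *)
Definition weight (w : R -> R) : Prop :=
  (forall x : R, 0 <= x -> 0 <= w x) /\
  (forall x y : R, 0 <= x -> x <= y -> w x <= w y) /\
  {within `[0, +oo[%classic, continuous w} /\
  w 0 = 0 /\
  (forall x y : R, 0 <= x -> 0 <= y -> w (x + y) <= w x + w y) /\
  (\int[@lebesgue_measure R]_(t in `[1%R, +oo[) (w t / t ^+ 2)%:E < +oo)%E /\
  w t / ln (1 + t) @[t --> +oo] --> +oo.

Variable n : nat.
Local Notation Rn := 'rV[R]_n.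

Definition point (t : n.-tuple R) : Rn := \row_i tnth t i.

Definition dotp (x y : Rn) : R := \sum_i x 0 i * y 0 i.

(* The library norm on 'rV[R]_n is the sup norm. *)
Definition euclid (x : Rn) : R := Num.sqrt (dotp x x).

Definition expi (t : R) : R[i] := cos t +i* sin t.

Definition complex_integral (F : Rn -> R[i]) : R[i] :=
  (\int[lebesgue_tuple n]_t complex.Re (F (point t)))
  +i* (\int[lebesgue_tuple n]_t complex.Im (F (point t))).

Definition fourier (f : Rn -> R[i]) (xi : Rn) : R[i] :=
  complex_integral (fun x => f x * expi (- dotp x xi)).

Definition wnorm (w : R -> R) (l : R) (f : Rn -> R[i]) : \bar R :=
  (\int[lebesgue_tuple n]_t
     (normc (fourier f (point t)) * expR (l * w (euclid (point t))))%:E)%E.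

(* R[i] carries no topology over the base field R, so continuity and
   differentiability are those of the real and imaginary parts. *)
Definition ccontinuous (f : Rn -> R[i]) : Prop :=
  continuous (fun x => complex.Re (f x)) /\
  continuous (fun x => complex.Im (f x)).

Fixpoint Ck (k : nat) (g : Rn -> R) : Prop :=
  continuous g /\
  match k with
  | 0 => True
  | k'.+1 => forall i : 'I_n,
      (forall x : Rn, derivable g x (delta_mx 0 i)) /\ Ck k' ('D_(delta_mx 0 i) g)
  end.

Definition smooth (f : Rn -> R[i]) : Prop :=
  forall k, Ck k (fun x => complex.Re (f x)) /\ Ck k (fun x => complex.Im (f x)).

Definition compactly_supported (f : Rn -> R[i]) : Prop :=
  compact (closure [set x | f x != 0]).

Inductive ultra := Beurling | Roumieu.

Definition testfun (s : ultra) (w : R -> R) (f : Rn -> R[i]) : Prop :=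
  ccontinuous f /\ compactly_supported f /\
  match s with
  | Beurling => forall l : R, 0 < l -> (wnorm w l f < +oo)%E
  | Roumieu => exists2 l : R, 0 < l & (wnorm w l f < +oo)%E
  end.

Definition ultrasmooth (s : ultra) (w : R -> R) (f : Rn -> R[i]) : Prop :=
  smooth f /\
  forall psi : Rn -> R[i], testfun s w psi -> testfun s w (fun x => psi x * f x).

Definition local_norm (s : ultra) (w : R -> R) (K : set Rn) (l : R)
    (f : Rn -> R[i]) : \bar R :=
  ereal_inf [set wnorm w l (fun x => psi x * f x) | psi in
    [set psi | testfun s w psi /\ (forall x : Rn, K x -> psi x = 1)]].

(* N eps = o(b eps) as eps -> 0+; N may be infinite away from 0. *)
Definition is_o (N : R -> \bar R) (b : R -> R) : Prop :=
  forall c : R, 0 < c -> \forall eps \near 0^'+, (N eps <= (c * b eps)%:E)%E.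

(* A net is a total function of eps; only its values on (0,1) matter. *)
Definition ultranet (s : ultra) (w : R -> R) (g : R -> Rn -> R[i]) : Prop :=
  forall eps : R, 0 < eps < 1 -> ultrasmooth s w (g eps).

Definition moderate (s : ultra) (w : R -> R) (g : R -> Rn -> R[i]) : Prop :=
  ultranet s w g /\
  forall K : set Rn, compact K ->
  let bounded h k := is_o (fun eps => local_norm s w K h (g eps))
                          (fun eps => expR (k * w (eps^-1))) in
  match s with
  | Beurling => forall h : R, 0 < h -> exists2 k : R, 0 < k & bounded h k
  | Roumieu => forall k : R, 0 < k -> exists2 h : R, 0 < h & bounded h k
  end.

Definition negligible_net (s : ultra) (w : R -> R) (g : R -> Rn -> R[i]) :
    Prop :=
  ultranet s w g /\
  forall K : set Rn, compact K ->
  let small h k := is_o (fun eps => local_norm s w K h (g eps))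
                        (fun eps => expR (- (k * w (eps^-1)))) in
  match s with
  | Beurling => forall h : R, 0 < h -> forall k : R, 0 < k -> small h k
  | Roumieu => exists2 k : R, 0 < k & exists2 h : R, 0 < h & small h k
  end.

(* Elements of the quotient algebra are represented by moderate nets; two of
   them are equal in the quotient when their difference is negligible. *)
Definition eq_gen (s : ultra) (w : R -> R) (f g : R -> Rn -> R[i]) : Prop :=
  negligible_net s w (fun eps x => f eps x - g eps x).

Definition translate (x : Rn) (f : R -> Rn -> R[i]) : R -> Rn -> R[i] :=
  fun eps y => f eps (y + x).

Definition moderate_number (s : ultra) (w : R -> R) (c : R -> R[i]) : Prop :=
  let bounded m := is_o (fun eps => (normc (c eps))%:E)
                        (fun eps => expR (m * w (eps^-1))) in
  match s with
  | Beurling => exists2 m : R, 0 < m & bounded m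
  | Roumieu => forall m : R, 0 < m -> bounded m
  end.

Definition constant_net (c : R -> R[i]) : R -> Rn -> R[i] := fun eps _ => c eps.

End ultradistributions.

(* Main.v *)
Require Import Defs.
From HB Require Import structures.
From mathcomp Require Import all_boot all_order all_algebra.
From mathcomp Require Import all_classical all_reals all_analysis.
From mathcomp Require Import complex measurable_realfun.
From mathcomp Require Import ring lra.

(** Put c eps = f eps 0.  The claim is that the net f - c is small in every
    local seminorm, and it is reached by three ideas.

    Pointwise smallness becomes uniform by Baire category.  Translation
    invariance says in particular that, for each x, |f eps x - f eps 0| is
    eventually below a negligible rate, from a threshold (and, in the Roumieu
    case, with an exponent) that depends on x.  The sets of points where a given
    threshold and exponent work are closed and cover R^n, so one of them
    contains a ball.  A compact set is covered by finitely many translates of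
    that ball, and invariance by these finitely many translations, uniform on
    compact sets, carries the estimate from the ball to the compact set
    ([translation_invariant_sup]).

    Uniform smallness becomes smallness in the weighted norms by interpolation.
    A bound on |chi (f - c)| bounds the modulus X of its Fourier transform by
    some D, and then X e^{h w} <= sqrt D (X e^{(2h+a) w} + e^{-a w}).  The first
    term is controlled by moderateness at the exponent 2h+a and the second one is
    integrable because w grows faster than the logarithm
    ([wnorm_interpolation], [local_norm_subr_cst_le], [interpolated_smallness]).

    The weighted norms are linked to values and to cutoffs by Fourier inversion.
    It gives (2 pi)^n |f x| <= wnorm w l f ([sup_le_wnorm]), which turns
    negligibility into sup bounds, and, w being subadditive, the
    submultiplicativity of the norms up to (2 pi)^n ([wnormM]), which moves
    moderateness, where the cutoff may depend on eps, to one fixed cutoff.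
    Inversion ([fourier_inversion]) is obtained by damping with the kernel
    prod_i e^{-d |xi_i|}, whose transform is a product of Poisson kernels, that
    is, an approximate identity as d tends to 0; everything about these kernels
    comes from antiderivatives on the line.

    No cutoff has to be constructed: a moderate net has finite local seminorms,
    which are infima over cutoffs, hence infima over nonempty sets
    ([moderate_cutoff]). *)

Set Implicit Arguments.
Unset Strict Implicit.
Unset Printing Implicit Defensive.

Import Order.TTheory GRing.Theory Num.Theory.
Import numFieldNormedType.Exports ComplexField.Normc.
(* Imported again so that point denotes the vector of a tuple and not the base
   point of a pointed type. *)
Import Defs.

Local Open Scope classical_set_scope.
Local Open Scope ring_scope.
Local Open Scope complex_scope.

(** * Integration over tuples *)

Section tuple_integrals.
Context {R : realType}.
Local Notation mR := (measurableTypeR R).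
Local Notation leb := (@lebesgue_measure R).

(** The norm on row vectors is the sup norm, so coordinate boxes form a
    basis of neighbourhoods. *)
Lemma rV_nearP n (x : 'rV[R]_n) (P : set 'rV[R]_n) :
  (\forall y \near x, P y) <->
  exists2 e : R, 0 < e & forall y : 'rV[R]_n, (forall i, `|x 0 i - y 0 i| < e) -> P y.
Proof.
split.
  move=> /nbhs_ballP[e e0 eP]; exists e => // y xy; apply: eP; split => // i j.
  by rewrite ord1; exact: xy.
move=> [e e0 eP]; apply/nbhs_ballP; exists e => // y [_ xy].
by apply: eP => i; exact: xy.
Qed.

(** The sigma-algebra on tuples is generated by the projections, not by the open
    sets of the vectors; a continuous function is measurable because it is the
    limit of its values at grid points of mesh 1/(k+1), and these
    discretizations take countably many values on boxes. *)
Lemma measurable_point n (g : 'rV[R]_n -> R) : continuous g ->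
  measurable_fun setT (fun t : n.-tuple mR => g (point t)).
Proof.
move=> cg.
pose disc (k : nat) (t : n.-tuple mR) : 'rV[int]_n :=
  \row_i Num.floor (k.+1%:R * (tnth t i : R)).
pose G (k : nat) (z : 'rV[int]_n) : R := g (\row_i ((z 0 i)%:~R / k.+1%:R)).
apply: (@measurable_realfun.measurable_fun_cvg _ _ _ setT
  (fun k t => G k (disc k t))).
- move=> k _ B mB; rewrite setTI.
  rewrite (_ : _ @^-1` B = \bigcup_z ([set t | G k z \in B] `&`
      \big[setI/setT]_(i < n) [set t : n.-tuple mR |
         ((z 0 i)%:~R <= k.+1%:R * (tnth t i : R) < (z 0 i + 1)%:~R)%R])); last first.
    apply/seteqP; split => [t /= Bt|t [z _ [/= Bz]]].
      exists (disc k t) => //; split; first by rewrite /= inE.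
      rewrite -bigcap_seq => i _ /=; rewrite mxE.
      by have /andP[-> ->] := floor_itv (k.+1%:R * (tnth t i : R)).
    rewrite -bigcap_seq => zt; move: Bz; rewrite inE; congr (B (G k _)).
    apply/rowP => i; rewrite mxE; apply/esym/floor_def.
    by apply: (zt i) => /=; rewrite mem_index_enum.
  apply: countable_bigcupT_measurable => [|z]; first exact: countableP.
  apply: measurableI.
    have [zB|zB] := boolP (G k z \in B).
      by rewrite (_ : mkset _ = setT)//; apply/seteqP; split.
    by rewrite (_ : mkset _ = set0)//; apply/seteqP; split.
  apply: bigsetI_measurable => i _.
  have m1 : measurable_fun setT (fun t : n.-tuple mR => k.+1%:R * (tnth t i : R)).
    by apply: measurable_funM => //; exact: measurable_tnth.
  have := m1 measurableT `[(z 0 i)%:~R, (z 0 i + 1)%:~R[%classic (measurable_itv _).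
  rewrite setTI => mB2; rewrite (_ : mkset _ =
    (fun t : n.-tuple mR => k.+1%:R * (tnth t i : R)) @^-1`
    `[(z 0 i)%:~R, (z 0 i + 1)%:~R[%classic)//.
- move=> t _; rewrite /G.
  apply: (@cvg_comp _ _ _ (fun k => \row_i ((disc k t 0 i)%:~R / k.+1%:R)) g
    _ (nbhs (point t))); last exact: cg.
  move=> A /rV_nearP[e e0 eA].
  suff : \forall k \near \oo, A (\row_i ((disc k t 0 i)%:~R / k.+1%:R)) by [].
  (* the floor at scale k + 1 misses the coordinate by less than 1/(k+1) *)
  near=> k; apply: eA => i; rewrite !mxE.
  set x : R := tnth t i.
  have k0 : 0 < k.+1%:R :> R by [].
  have /andP[h1 h2] := floor_itv (k.+1%:R * x).
  have -> : x - (Num.floor (k.+1%:R * x))%:~R / k.+1%:R =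
     (k.+1%:R * x - (Num.floor (k.+1%:R * x))%:~R) / k.+1%:R.
    by field; rewrite gt_eqF.
  rewrite ger0_norm; last by rewrite divr_ge0// subr_ge0.
  rewrite ltr_pdivrMr//.
  have : 1 < e * k.+1%:R.
    rewrite -ltr_pdivrMr// mul1r; near: k; exact: (near_infty_natSinv_lt (PosNum e0)).
  rewrite intrD in h2; lra.
Unshelve. all: by end_near. Qed.

(** Since the measure on n+1-tuples is the image of a product measure, Tonelli
    reduces integrals in dimension n+1 to dimension n; the explicit
    n-dimensional integrals below are computed by induction with this identity. *)
Lemma ge0_integral_tuple_cons n (f : n.+1.-tuple mR -> \bar R) :
  measurable_fun setT f -> (forall t, (0 <= f t)%E) ->
  (\int[lebesgue_tuple n.+1]_t f t =
   \int[leb]_x \int[lebesgue_tuple n]_t f (tuple_cons (x, t)))%E.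
Proof.
move=> mf f0.
transitivity (\int[pushforward (leb \x lebesgue_tuple n)%E (@tuple_cons R n)]_t f
  t)%E.
  by [].
rewrite (ge0_integral_pushforward (@measurable_tuple_cons R n))//.
rewrite preimage_setT fubini_tonelli1//; last by move=> x; exact: f0.
by apply: measurableT_comp => //; exact: measurable_tuple_cons.
Qed.

Lemma integral_tuple0 (f : 0.-tuple mR -> \bar R) :
  measurable_fun setT f ->
  (\int[lebesgue_tuple 0]_t f t = f [tuple])%E.
Proof. by move=> mf; rewrite /= integral_dirac// diracT mul1e. Qed.

Lemma measurable_tuple_consr n x : measurable_fun setT
  (fun t : n.-tuple mR => @tuple_cons R n (x, t)).
Proof.
apply: (measurableT_comp (@measurable_tuple_cons R n)).
exact: measurable_pair1.
Qed.

Lemma measurable_integral_tuple_cons n (f : n.+1.-tuple mR -> \bar R) :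
  measurable_fun setT f -> (forall t, (0 <= f t)%E) ->
  measurable_fun setT (fun x : mR =>
    \int[lebesgue_tuple n]_t f (tuple_cons (x, t)))%E.
Proof.
move=> mf f0.
apply: (@measurable_fun_fubini_tonelli_F _ _ _ _ _ (lebesgue_tuple n)
  (f \o @tuple_cons R n)).
  by apply: measurableT_comp => //; exact: measurable_tuple_cons.
by move=> x; exact: f0.
Qed.

Lemma tnth_tuple_cons0 n x (t : n.-tuple mR) : tnth (tuple_cons (x, t)) ord0 = x.
Proof. by rewrite tnth0. Qed.

Lemma tnth_tuple_consS n x (t : n.-tuple mR) i :
  tnth (tuple_cons (x, t)) (lift ord0 i) = tnth t i.
Proof. by rewrite tnthS. Qed.

Lemma integral_prod_tuple n (h : R -> R) (C : R) : measurable_fun [set: mR] h ->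
  (forall x, 0 <= h x) -> (\int[leb]_x (h x)%:E = C%:E)%E ->
  (\int[lebesgue_tuple n]_t (\prod_(i < n) h (tnth t i))%:E = (C ^+ n)%:E)%E.
Proof.
move=> mh h0 hC.
have mprod k : measurable_fun setT
  (fun t : k.-tuple mR => (\prod_(i < k) h (tnth t i))%:E).
  apply/measurable_EFinP/measurable_prod => i _.
  by apply: measurableT_comp => //; exact: measurable_tnth.
have prod0 k (t : k.-tuple mR) : (0 <= (\prod_(i < k) h (tnth t i))%:E)%E.
  by rewrite lee_fin prodr_ge0.
elim: n => [|n IHn]; first by rewrite integral_tuple0// big_ord0 expr0.
rewrite ge0_integral_tuple_cons//.
transitivity (\int[leb]_x ((h x)%:E * (C ^+ n)%:E))%E.
  apply: eq_integral => x _.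
  rewrite -IHn -ge0_integralZl//; first last.
  - by rewrite lee_fin.
  - exact: mprod.
  apply: eq_integral => t _.
  rewrite big_ord_recl tnth_tuple_cons0 EFinM.
  by congr (_ * (_)%:E)%E; apply: eq_bigr => i _; rewrite tnth_tuple_consS.
have C0 : 0 <= C by rewrite -lee_fin -hC; apply: integral_ge0 => z _; rewrite lee_fin.
rewrite ge0_integralZr//.
- by rewrite hC -EFinM exprS.
- exact/measurable_EFinP.
- by move=> x _; rewrite lee_fin.
- by rewrite lee_fin exprn_ge0.
Qed.

End tuple_integrals.

(** * Affine changes of variables *)

Section affine.
Context {R : realType}.
Local Notation mR := (measurableTypeR R).
Local Notation leb := (@lebesgue_measure R).

Lemma measurable_affine1 (y d : R) : measurable_fun [set: mR]
  (fun u : mR => y + d * u : mR).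
Proof. by apply: measurable_funD => //; exact: measurable_funM. Qed.

(** Both sides are measures in A that agree on half-open intervals. *)
Lemma lebesgue_affine (y d : R) (A : set mR) : 0 < d -> measurable A ->
  leb A = (d%:E * leb ((fun u : mR => (y + d * u)%R : mR) @^-1` A))%E.
Proof.
move=> d0 mA.
pose mf1 := measurable_affine1 y d.
pose p : {measure set mR -> \bar R} :=
  @pushforward _ _ mR mR R leb (fun u : mR => y + d * u).
rewrite (@lebesgue_measure_unique _ (mscale (PosNum d0)%:num%:nng (p mf1)))// =>
  _ [[a b] _ <-] /=.
rewrite /mscale/= /pushforward.
rewrite (_ : _ @^-1` _ = `](a - y) / d, (b - y) / d]%classic); last first.
  apply/seteqP; split => u /=; rewrite !in_itv/= ltr_pdivrMr// ler_pdivlMr// =>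
    /andP[? ?]; apply/andP; split; lra.
rewrite !lebesgue_measure_itv/= !lte_fin ltr_pM2r ?invr_gt0// ltrD2r.
case: ifPn => _; last by rewrite mule0.
by rewrite -!EFinB -EFinM; congr EFin; field; rewrite gt_eqF.
Qed.

Lemma ge0_integral_affine1 (y d : R) (f : mR -> \bar R) : 0 < d ->
  measurable_fun setT f -> (forall x, (0 <= f x)%E) ->
  (\int[leb]_u f (y + d * u)%R = (d^-1)%:E * \int[leb]_x f x)%E.
Proof.
move=> d0 mf f0.
pose mf1 := measurable_affine1 y d.
pose p : {measure set mR -> \bar R} :=
  @pushforward _ _ mR mR R leb (fun u : mR => y + d * u).
rewrite [in RHS](eq_measure_integral (mscale (PosNum d0)%:num%:nng (p mf1)));
  last first.
  by move=> A mA _; exact: lebesgue_affine.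
rewrite ge0_integral_mscale//= muleA -EFinM mulVf ?gt_eqF// mul1e.
by rewrite ge0_integral_pushforward.
Qed.

Definition affine_tuple n (y : 'rV[R]_n) (d : R) (t : n.-tuple mR) : n.-tuple mR :=
  [tuple y 0 i + d * tnth t i | i < n].

Lemma point_affine n (y : 'rV[R]_n) (d : R) t :
  point (affine_tuple y d t) = y + d *: point t.
Proof. by apply/rowP => i; rewrite !mxE tnth_mktuple. Qed.

Lemma measurable_affine n (y : 'rV[R]_n) d : measurable_fun setT (affine_tuple y d).
Proof.
apply/measurable_fun_tnthP => i.
apply: (eq_measurable_fun (fun t : n.-tuple mR => y 0 i + d * tnth t i)).
  by move=> t _ /=; rewrite tnth_mktuple.
apply: measurable_funD => //; apply: measurable_funM => //; exact: measurable_tnth.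
Qed.

(** With d = 1 this is translation invariance; with y fixed and d tending to 0 it
    rescales Poisson kernels to a fixed kernel. *)
Lemma ge0_integral_affine n (y : 'rV[R]_n) (d : R) (f : n.-tuple mR -> \bar R) :
  0 < d -> measurable_fun setT f -> (forall t, (0 <= f t)%E) ->
  (\int[lebesgue_tuple n]_t f (affine_tuple y d t) =
   (d ^- n)%:E * \int[lebesgue_tuple n]_t f t)%E.
Proof.
move=> d0.
elim: n y f => [|n IHn] y f mf f0.
  rewrite !integral_tuple0//; last by apply: measurableT_comp => //;
    exact: measurable_affine.
  by rewrite expr0 invr1 mul1e; congr f; exact: tuple0.
rewrite !ge0_integral_tuple_cons//; last by apply: measurableT_comp => //;
  exact: measurable_affine.
pose y' : 'rV[R]_n := \row_i y 0 (lift ord0 i).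
(* first the n last coordinates by induction, then the first one *)
pose g (x : mR) : \bar R := (\int[lebesgue_tuple n]_t f (tuple_cons (x, t)))%E.
transitivity (\int[leb]_x ((d ^- n)%:E * g (y 0 ord0 + d * x)%R))%E.
  apply: eq_integral => x _.
  rewrite -(IHn y' (fun t => f (tuple_cons (y 0 ord0 + d * x, t)))) //.
    apply: eq_integral => t _; congr f; apply: eq_from_tnth => i.
    case: (unliftP ord0 i) => [j|] ->; rewrite !tnth_mktuple.
      by rewrite !tnth_tuple_consS tnth_mktuple mxE.
    by rewrite !tnth_tuple_cons0.
  by apply: measurableT_comp => //; exact: measurable_tuple_consr.
have mg : measurable_fun setT g by exact: measurable_integral_tuple_cons.
have g0 x : (0 <= g x)%E by exact: integral_ge0.
have dn0 : (0 <= (d ^- n)%:E)%E by rewrite lee_fin invr_ge0 exprn_ge0// ltW.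
rewrite ge0_integralZl//; last first.
  by apply: measurableT_comp => //; exact: measurable_affine1.
by rewrite ge0_integral_affine1// muleA -EFinM exprSr invfM.
Qed.

End affine.

(** * Damped trigonometric integrals on the half-line and the line *)

Section kernel.
Context {R : realType}.
Local Notation leb := (@lebesgue_measure R).

(** Functions of this shape are stable under differentiation, which is what
    makes their antiderivatives explicit. *)
Lemma is_derive_damped_trig (d z a p q : R) (x : R) :
  is_derive x 1 (fun x => expR (- (d * x)) * (a + p * cos (z * x) + q * sin (z * x)))
   (expR (- (d * x)) * ((z * q - d * p) * cos (z * x) - (z * p + d * q) * sin
     (z * x)- d * a)).
Proof.
have h1 : is_derive x 1 (fun x : R => - (d * x)) (- d).
  by apply: is_derive_eq; rewrite ?/GRing.scale/=; ring.
have h2 : is_derive x 1 (fun x : R => z * x) z.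
  by apply: is_derive_eq; rewrite ?/GRing.scale/=; ring.
have h3 : is_derive x 1 (fun x : R => expR (- (d * x))) (expR (- (d * x)) * - d).
  exact: (@is_derive1_comp _ expR (fun x => - (d * x)) x _ _ (is_derive_expR _) h1).
have h4 : is_derive x 1 (fun x : R => cos (z * x)) (- sin (z * x) * z).
  exact: (@is_derive1_comp _ cos (fun x => z * x) x _ _ (is_derive_cos _) h2).
have h5 : is_derive x 1 (fun x : R => sin (z * x)) (cos (z * x) * z).
  exact: (@is_derive1_comp _ sin (fun x => z * x) x _ _ (is_derive_sin _) h2).
apply: is_derive_eq.
rewrite /GRing.scale/=.
ring.
Qed.

Lemma continuous_damped_trig (d z a p q : R) :
  continuous (fun x => expR (- (d * x)) * (a + p * cos (z * x) + q * sin (z * x))).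
Proof.
move=> x; apply/differentiable_continuous/derivable1_diffP.
by have [] := is_derive_damped_trig d z a p q x.
Qed.

(** Cauchy-Schwarz; the condition on a makes a + p cos + q sin nonnegative, so
    that the integrals below can be handled by Tonelli and by the fundamental
    theorem of calculus for nonnegative functions. *)
Lemma normr_trig_le (a p q th : R) : 0 <= a -> p ^+ 2 + q ^+ 2 <= a ^+ 2 ->
  `|p * cos th + q * sin th| <= a.
Proof.
move=> a0 pq.
rewrite -(ler_pXn2r (ltn0Sn 1)) ?nnegrE// real_normK ?num_real//.
apply: le_trans pq.
have := cos2Dsin2 th; have := sqr_ge0 (p * sin th - q * cos th).
nra.
Qed.

Lemma cvg_damped_trig (d z a p q : R) : 0 < d ->
  expR (- (d * x)) * (a + p * cos (z * x) + q * sin (z * x)) @[x --> +oo] --> (0 : R).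
Proof.
move=> d0.
have e0 : expR (- (d * x)) @[x --> +oo] --> (0 : R).
  apply: (@cvg_comp _ _ _ (fun x => d * x) (fun x => expR (- x)) _ (+oo));
    last exact: cvgr_expR.
  exact: gt0_cvgMry.
pose M := `|a| + (`|p| + `|q|).
have bM x : `|a + p * cos (z * x) + q * sin (z * x)| <= M.
  apply: (le_trans (ler_normD _ _)); rewrite /M addrA; apply: lerD.
    apply: (le_trans (ler_normD _ _)); apply: lerD => //.
    by rewrite normrM ler_piMr// ler_norml cos_geN1 cos_le1.
  by rewrite normrM ler_piMr// ler_norml sin_geN1 sin_le1.
apply/cvgr0Pnorm_le => /= e e0'.
have M1 : 0 < M + 1 by rewrite ltr_wpDl// !addr_ge0.
near=> x.
rewrite normrM; apply: (@le_trans _ _ (e / (M + 1) * (M + 1))); last first.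
  by rewrite divfK ?gt_eqF.
apply: ler_pM => //; last by apply: (le_trans (bM x)); lra.
near: x; apply: (cvgr0_norm_le _ e0); exact: divr_gt0.
Unshelve. all: by end_near. Qed.

Lemma integral0y_damped_trig (d z a p q : R) : 0 < d -> 0 <= a ->
  p ^+ 2 + q ^+ 2 <= a ^+ 2 ->
  (\int[leb]_(x in `[0%R, +oo[) (expR (- (d * x)) *
    (a + p * cos (z * x) + q * sin (z * x)))%:E =
   (a / d + (p * d + q * z) / (d ^+ 2 + z ^+ 2))%:E)%E.
Proof.
move=> d0 a0 pq.
have D0 : 0 < d ^+ 2 + z ^+ 2 by rewrite ltr_pwDl ?sqr_ge0// exprn_gt0.
pose D := d ^+ 2 + z ^+ 2.
(* the antiderivative vanishing at infinity *)
pose F x := expR (- (d * x)) * (- a / d + ((- p * d - q * z) / D) * cos (z * x)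
  + ((p * z - q * d) / D) * sin (z * x)).
rewrite (@ge0_continuous_FTC2y _ _ F 0 0).
- rewrite /F !mulr0 oppr0 expR0 cos0 sin0 -EFinB; congr EFin.
  by rewrite /D; field; rewrite !gt_eqF.
- move=> x _; rewrite mulr_ge0 ?expR_ge0//.
  by have := normr_trig_le (z * x) a0 pq; rewrite ler_norml => /andP[]; lra.
- exact/continuous_subspaceT/continuous_damped_trig.
- exact: cvg_damped_trig.
- by move=> x _; have [] := is_derive_damped_trig d z (- a / d)
    ((- p * d - q * z) / D) ((p * z - q * d) / D) x.
- apply: cvg_at_right_filter; exact: continuous_damped_trig.
- move=> x _; rewrite derive1E.
  have [_ ->] := is_derive_damped_trig d z (- a / d) ((- p * d - q * z) / D)
    ((p * z - q * d) / D) x.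
  congr (_ * _); rewrite /D; field; by rewrite !gt_eqF.
Qed.

(** The Fourier transform of e^{-d |x|}, in a form that covers real and imaginary
    parts at once.  The odd contributions of the two half-lines cancel.  The
    constant a keeps the integrand nonnegative. *)
Lemma integral_damped_trig (d z a p q : R) : 0 < d -> 0 <= a ->
  p ^+ 2 + q ^+ 2 <= a ^+ 2 ->
  (\int[leb]_x (expR (- (d * `|x|)) * (a + p * cos (z * x) + q * sin (z * x)))%:E =
   (a * (2 / d) + p * (2 * d / (d ^+ 2 + z ^+ 2)))%:E)%E.
Proof.
move=> d0 a0 pq.
have D0 : 0 < d ^+ 2 + z ^+ 2 by rewrite ltr_pwDl ?sqr_ge0// exprn_gt0.
pose G (x : R) := expR (- (d * `|x|)) * (a + p * cos (z * x) + q * sin (z * x)).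
have G0 x : 0 <= G x.
  rewrite mulr_ge0 ?expR_ge0//.
  by have := normr_trig_le (z * x) a0 pq; rewrite ler_norml => /andP[]; lra.
have ct : continuous (fun x : R => a + p * cos (z * x) + q * sin (z * x)).
  rewrite (_ : (fun _ => _) = (fun x =>
    expR (- (0 * x)) * (a + p * cos (z * x) + q * sin (z * x)))).
    exact: continuous_damped_trig.
  by apply/funext => x; rewrite mul0r oppr0 expR0 mul1r.
have cG : continuous G.
  move=> x; apply: cvgM.
    apply: (@continuous_comp _ _ _ (fun x : R => - (d * `|x|)) expR);
      last exact: continuous_expR.
    by apply: cvgN; apply: cvgM; [exact: cvg_cst|exact: norm_continuous].
  exact: ct.
have mG : measurable_fun setT G by exact: continuous_measurable_fun.
have -> : [set: R] = `]-oo, 0%R] `|` `]0%R, +oo[ by rewrite -setCitvr setvU.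
rewrite ge0_integral_setU//=; first last.
- by rewrite disj_set2E; apply/eqP; rewrite -subset0 => x/=;
    rewrite !in_itv/= andbT ltNge => -[? /negP].
- by move=> x _; rewrite lee_fin; exact: G0.
- exact/measurable_EFinP/measurable_funTS.
(* x |-> - x changes the sign of q *)
rewrite -{1}oppr0 ge0_integration_by_substitutionNy; first last.
- by move=> x _; exact: G0.
- exact: continuous_subspaceT.
rewrite integral_itv_obnd_cbnd; last exact/measurable_EFinP/measurable_funTS.
transitivity ((a / d + (p * d + (- q) * z) / (d ^+ 2 + z ^+ 2))%:E
  + (a / d + (p * d + q * z) / (d ^+ 2 + z ^+ 2))%:E)%E.
  rewrite -(integral0y_damped_trig z d0 a0 pq).
  rewrite -(@integral0y_damped_trig d z a p (- q))// ?sqrrN//.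
  congr (_ + _)%E; apply: eq_integral => x; rewrite inE/= in_itv/= andbT => x0.
    by rewrite normrN ger0_norm// mulrN cosN sinN mulNr mulrN.
  by rewrite ger0_norm.
by rewrite -EFinD; congr EFin; field; rewrite !gt_eqF.
Qed.

End kernel.

(** * The Laplace and Poisson kernels in several variables *)

Section kernel_tuple.
Context {R : realType}.
Local Notation mR := (measurableTypeR R).
Local Notation leb := (@lebesgue_measure R).

(** A product over coordinates, not a function of the Euclidean norm: this is
    what makes its Fourier transform factor. *)
Definition laplace_kernel n (d : R) (t : n.-tuple mR) : R :=
  \prod_(i < n) expR (- (d * `|tnth t i : R|)).

(** The Fourier transform of [laplace_kernel]. *)
Definition poisson_kernel n (d : R) (z : 'rV[R]_n) : R :=
  \prod_(i < n) (2 * d / (d ^+ 2 + z 0 i ^+ 2)).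

Lemma laplace_gt0 n d (t : n.-tuple mR) : 0 < laplace_kernel d t.
Proof. by apply: prodr_gt0 => i _; exact: expR_gt0. Qed.

Lemma laplace_le1 n d (t : n.-tuple mR) : 0 < d -> laplace_kernel d t <= 1.
Proof.
move=> d0; apply: prodr_ile1 => i _; rewrite expR_ge0/= -expR0 ler_expR.
by rewrite oppr_le0 mulr_ge0// ltW.
Qed.

Lemma poisson_ge0 n d (z : 'rV[R]_n) : 0 < d -> 0 <= poisson_kernel d z.
Proof.
move=> d0; apply: prodr_ge0 => i _; rewrite divr_ge0 ?mulr_ge0 ?(ltW d0)//.
by rewrite addr_ge0 ?sqr_ge0.
Qed.

Lemma poisson_le n d (z : 'rV[R]_n) : 0 < d -> poisson_kernel d z <= (2 / d) ^+ n.
Proof.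
move=> d0.
rewrite -[X in _ ^+ X]card_ord -prodr_const; apply: ler_prod => i _.
have D0 : 0 < d ^+ 2 + z 0 i ^+ 2 by rewrite ltr_pwDl ?sqr_ge0// exprn_gt0.
rewrite divr_ge0 ?mulr_ge0 ?(ltW d0) ?(ltW D0)//=.
rewrite ler_pdivrMr// mulrAC ler_pdivlMr//; have := sqr_ge0 (z 0 i); nra.
Qed.

Lemma measurable_laplace n d : measurable_fun setT (@laplace_kernel n d).
Proof.
apply: measurable_prod => i _.
apply: (measurableT_comp (@measurable_expR R)).
apply: measurableT_comp => //; apply: measurable_funM => //.
by apply: measurableT_comp => //; exact: measurable_tnth.
Qed.

Lemma measurable_dotp_tuple n (z : 'rV[R]_n) :
  measurable_fun setT (fun t : n.-tuple mR => dotp z (point t)).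
Proof.
apply: measurable_sum => i; apply: measurable_funM => //.
apply: (eq_measurable_fun (fun t : n.-tuple mR => tnth t i));
  last exact: measurable_tnth.
by move=> t _; rewrite mxE.
Qed.

Lemma dotp_tuple_cons n (z : 'rV[R]_n.+1) x (t : n.-tuple mR) :
  dotp z (point (tuple_cons (x, t))) = z 0 ord0 * x + dotp
    (\row_i z 0 (lift ord0 i)) (point t).
Proof.
rewrite /dotp big_ord_recl mxE tnth_tuple_cons0; congr (_ + _).
by apply: eq_bigr => i _; rewrite !mxE tnth_tuple_consS.
Qed.

Lemma measurable_laplace_trig n (d a p q : R) (z : 'rV[R]_n) :
  measurable_fun setT (fun t : n.-tuple mR => laplace_kernel d t *
    (a + p * cos (dotp z (point t)) + q * sin (dotp z (point t)))).
Proof.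
apply: measurable_funM; first exact: measurable_laplace.
have mc : measurable_fun setT (@cos R) by apply: continuous_measurable_fun;
  exact: continuous_cos.
have ms : measurable_fun setT (@sin R) by apply: continuous_measurable_fun;
  exact: continuous_sin.
apply: measurable_funD; [apply: measurable_funD => //|]; apply: measurable_funM => //.
- by apply: (measurableT_comp mc); exact: measurable_dotp_tuple.
- by apply: (measurableT_comp ms); exact: measurable_dotp_tuple.
Qed.

(** Induction on the dimension: for a fixed first coordinate x, the addition
    formulas turn the integrand into one of the same shape in the remaining
    coordinates, where the vector (p, q) is rotated by the angle z_0 x and hence
    keeps its norm. *)
Lemma integral_laplace_trig n (d a p q : R) (z : 'rV[R]_n) :
  0 < d -> 0 <= a -> p ^+ 2 + q ^+ 2 <= a ^+ 2 ->
  (\int[lebesgue_tuple n]_t (laplace_kernel d t *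
    (a + p * cos (dotp z (point t)) + q * sin (dotp z (point t))))%:E =
   (a * (2 / d) ^+ n + p * poisson_kernel d z)%:E)%E.
Proof.
move=> d0; elim: n a p q z => [|n IHn] a p q z a0 pq.
  rewrite integral_tuple0.
    rewrite /laplace_kernel /poisson_kernel /dotp !big_ord0 cos0 sin0 expr0 !mulr1
      mulr0 addr0 mul1r.
    by [].
  by apply/measurable_EFinP; exact: measurable_laplace_trig.
rewrite ge0_integral_tuple_cons; last 2 first.
- apply/measurable_EFinP; exact: measurable_laplace_trig.
- move=> t; rewrite lee_fin mulr_ge0 ?(ltW (laplace_gt0 _ _))//.
  by have := normr_trig_le (dotp z (point t)) a0 pq; rewrite ler_norml => /andP[];
    lra.
pose z' : 'rV[R]_n := \row_i z 0 (lift ord0 i).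
pose z0 := z 0 ord0.
have P0 := poisson_ge0 z' d0.
have P1 := poisson_le z' d0.
transitivity (\int[leb]_x (expR (- (d * `|x|)) *
   (a * (2 / d) ^+ n + p * poisson_kernel d z' * cos (z0 * x) + q * poisson_kernel
     d z' * sin (z0 * x)))%:E)%E.
  apply: eq_integral => x _.
  (* (p', q') is (p, q) rotated by the angle z0 x *)
  pose p' := p * cos (z0 * x) + q * sin (z0 * x).
  pose q' := q * cos (z0 * x) - p * sin (z0 * x).
  have pq' : p' ^+ 2 + q' ^+ 2 <= a ^+ 2.
    suff -> : p' ^+ 2 + q' ^+ 2 = (p ^+ 2 + q ^+ 2) *
      (cos (z0 * x) ^+ 2 + sin (z0 * x) ^+ 2).
      by rewrite cos2Dsin2 mulr1.
    by rewrite /p' /q'; ring.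
  rewrite (_ : a * _ + _ + _ = a * (2 / d) ^+ n + p' * poisson_kernel d z');
    last by rewrite /p'; ring.
  rewrite EFinM -(IHn _ _ _ _ a0 pq') -ge0_integralZl; last 4 first.
  - exact: measurableT.
  - apply/measurable_EFinP; exact: measurable_laplace_trig.
  - move=> t _; rewrite lee_fin mulr_ge0 ?(ltW (laplace_gt0 _ _))//.
    by have := normr_trig_le (dotp z' (point t)) a0 pq'; rewrite ler_norml =>
      /andP[]; lra.
  - by rewrite lee_fin expR_ge0.
  apply: eq_integral => t _; rewrite -EFinM; congr EFin.
  rewrite /laplace_kernel big_ord_recl tnth_tuple_cons0 -mulrA; congr (_ * _).
  congr (_ * _); first by apply: eq_bigr => i _; rewrite tnth_tuple_consS.
  rewrite dotp_tuple_cons -/z' -/z0 cosD sinD /p' /q'; ring.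
rewrite integral_damped_trig//.
- have -> : poisson_kernel d z = 2 * d / (d ^+ 2 + z0 ^+ 2) * poisson_kernel d z'.
    by rewrite /poisson_kernel big_ord_recl; congr (_ * _); apply: eq_bigr => i _;
      rewrite !mxE.
  congr (_ + _)%:E; first by rewrite (exprSr _ n) [RHS]mulrA.
  by rewrite -mulrA; congr (_ * _); rewrite mulrC.
- by rewrite mulr_ge0// exprn_ge0// divr_ge0// ltW.
have P2 : poisson_kernel d z' ^+ 2 <= ((2 / d) ^+ n) ^+ 2.
  by rewrite ler_pXn2r// nnegrE exprn_ge0// divr_ge0// ltW.
rewrite [(p * _) ^+ 2]exprMn [(q * _) ^+ 2]exprMn [(a * _) ^+ 2]exprMn -mulrDl.
by apply: ler_pM => //; rewrite ?addr_ge0 ?sqr_ge0.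
Qed.

(** The one-dimensional mass of the Poisson kernel, and the origin of the constant
    2 pi in all the estimates below. *)
Lemma integral_cauchy : (\int[leb]_x (2 / (1 + x ^+ 2))%:E = (2 * pi)%:E)%E.
Proof.
have p0 (x : R) : 0 < 1 + x ^+ 2 by rewrite ltr_pwDl ?sqr_ge0.
have cc : continuous (fun x : R => 2 / (1 + x ^+ 2)).
  move=> x; apply: cvgM; first exact: cvg_cst.
  apply: cvgV; first by rewrite gt_eqF.
  apply: cvgD; first exact: cvg_cst.
  exact: exprn_continuous.
rewrite ge0_symfun_integralT//; first last.
- by move=> x /=; rewrite sqrrN.
- by move=> x; rewrite divr_ge0// ltW.
rewrite -set_itvcy.
have da (x : R) : is_derive x 1 (fun x => 2 * atan x) (2 / (1 + x ^+ 2)).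
  by apply: is_derive_eq; rewrite ?/GRing.scale/=; ring.
rewrite (@ge0_continuous_FTC2y _ _ (fun x => 2 * atan x) 0 pi).
- by rewrite atan0 mulr0 sube0 EFinM.
- by move=> x _; rewrite divr_ge0// ltW.
- exact: continuous_subspaceT.
- rewrite [X in _ --> X](_ : _ = 2 * (pi / 2)); last by field.
  by apply: cvgM; [exact: cvg_cst|exact: cvgy_atan].
- by move=> x _; have [] := da x.
- apply: cvg_at_right_filter; apply: cvgM; first exact: cvg_cst.
  exact: continuous_atan.
- by move=> x _; rewrite derive1E; have [] := da x.
Qed.

Lemma integral_poisson1 n :
  (\int[lebesgue_tuple n]_t (poisson_kernel 1 (point t))%:E = ((2 * pi) ^+ n)%:E)%E.
Proof.
rewrite -(@integral_prod_tuple _ _ (fun x : R => 2 / (1 + x ^+ 2))).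
- apply: eq_integral => t _; congr EFin; apply: eq_bigr => i _.
  by rewrite mxE mulr1 expr1n.
- apply: measurable_funM => //; apply: measurable_funTS.
  apply: continuous_measurable_fun => x; apply: cvgV;
    first by rewrite gt_eqF// ltr_pwDl ?sqr_ge0.
  by apply: cvgD; [exact: cvg_cst|exact: exprn_continuous].
- by move=> x; rewrite divr_ge0// addr_ge0// sqr_ge0.
- exact: integral_cauchy.
Qed.

End kernel_tuple.

(** * Fubini and dominated convergence for real-valued integrals *)

Section generic_integration.
Context {R : realType} d1 d2 (T1 : measurableType d1) (T2 : measurableType d2).
Variables (m1 : {sigma_finite_measure set T1 -> \bar R})
          (m2 : {sigma_finite_measure set T2 -> \bar R}).

(** The integral of a signed function is the difference of the integrals of its
    positive and negative parts, to which Tonelli applies. *)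
Lemma measurable_Rintegral_snd (F : T1 * T2 -> R) : measurable_fun setT F ->
  measurable_fun setT (fun x => \int[m2]_y F (x, y)).
Proof.
move=> mF.
have mE : measurable_fun setT (EFin \o F) by exact/measurable_EFinP.
suff : measurable_fun setT (fun x => \int[m2]_y (F (x, y))%:E)%E.
  by move=> m; apply: (measurableT_comp (fine_measurable measurableT) m).
rewrite (_ : (fun x => _) = (fun x =>
   \int[m2]_y ((EFin \o F)^\+ (x, y)) - \int[m2]_y ((EFin \o F)^\- (x, y)))%E);
     last first.
  apply/funext => x; rewrite [LHS]integralE; congr (_ - _)%E; apply: eq_integral =>
    y _.
    by rewrite !funeposE.
  by rewrite !funenegE.
apply: emeasurable_funB.
- apply: (@measurable_fun_fubini_tonelli_F _ _ _ _ _ m2 ((EFin \o F)^\+)%E) => //.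
  exact: measurable_funepos.
- apply: (@measurable_fun_fubini_tonelli_F _ _ _ _ _ m2 ((EFin \o F)^\-)%E) => //.
  exact: measurable_funeneg.
Qed.

(** Domination by a product of integrable functions makes all sections
    integrable, not only almost all of them, so that the iterated real-valued
    integrals involve no exceptional set. *)
Lemma Rintegral_Fubini_le (F : T1 * T2 -> R) (A : T1 -> R) (B : T2 -> R) :
  measurable_fun setT F -> m1.-integrable setT (EFin \o A) ->
    m2.-integrable setT (EFin \o B) ->
  (forall x y, `|F (x, y)| <= A x * B y) ->
  \int[m1]_x \int[m2]_y F (x, y) = \int[m2]_y \int[m1]_x F (x, y).
Proof.
move=> mF iA iB FAB.
have mE : measurable_fun setT (EFin \o F) by exact/measurable_EFinP.
have i1 x : m2.-integrable setT (fun y => (F (x, y))%:E).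
  apply: (@le_integrable _ _ _ m2 setT measurableT _
    (fun y => (A x)%:E * (B y)%:E)%E).
  - by apply: (measurableT_comp mE); exact: measurable_pair1.
  - by move=> y _; rewrite /= lee_fin (le_trans (FAB _ _))// ler_norm.
  - exact: integrableZl.
have i2 y : m1.-integrable setT (fun x => (F (x, y))%:E).
  apply: (@le_integrable _ _ _ m1 setT measurableT _
    (fun x => (A x)%:E * (B y)%:E)%E).
  - by apply: (measurableT_comp mE); exact: measurable_pair2.
  - by move=> x _; rewrite /= lee_fin (le_trans (FAB _ _))// ler_norm.
  - exact: integrableZr.
have i12 : (m1 \x m2)%E.-integrable setT (EFin \o F).
  apply/integrable12ltyP => //.
  have mB : measurable_fun setT (EFin \o B) by case/integrableP : iB.
  have mA : measurable_fun setT (EFin \o A) by case/integrableP : iA.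
  apply: (@le_lt_trans _ _ (\int[m1]_x (`|(A x)%:E| * (\int[m2]_y `|(B y)%:E|)))%E).
    apply: ge0_le_integral => //.
    - by move=> x _; exact: integral_ge0.
    - apply: (@measurable_fun_fubini_tonelli_F _ _ _ _ _ m2
        (fun z => `|(EFin \o F) z|)%E) => //.
      exact: measurableT_comp.
    - by apply: emeasurable_funM => //; exact: measurableT_comp.
    - move=> x _; rewrite -ge0_integralZl//; last exact: measurableT_comp.
      apply: ge0_le_integral => //.
      + by apply: measurableT_comp => //; apply: (measurableT_comp mE);
          exact: measurable_pair1.
      + by apply: emeasurable_funM => //; exact: measurableT_comp.
      + by move=> y _; rewrite /= -EFinM lee_fin (le_trans (FAB _ _))// -normrM
          ler_norm.
  rewrite ge0_integralZr//; last 2 first.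
  - exact: measurableT_comp.
  - exact: integral_ge0.
  apply: lte_mul_pinfty; first exact: integral_ge0.
  - rewrite ge0_fin_numE; last exact: integral_ge0.
    by case/integrableP : iA.
  - by case/integrableP : iB.
congr fine.
transitivity (\int[m1]_x \int[m2]_y (EFin \o F) (x, y))%E.
  by apply: eq_integral => x _; rewrite fineK//; exact: integrable_fin_num.
rewrite Fubini//; apply: eq_integral => y _.
by rewrite fineK//; exact: integrable_fin_num.
Qed.

Lemma integral_EFin_Rintegral (f : T1 -> R) : m1.-integrable setT (EFin \o f) ->
  (\int[m1]_x (f x)%:E = (\int[m1]_x f x)%:E)%E.
Proof. by move=> i; rewrite /Rintegral fineK//; exact: integrable_fin_num. Qed.

Lemma dominated_cvg_Rintegral (f_ : nat -> T1 -> R) (f g : T1 -> R) :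
  (forall k, measurable_fun setT (f_ k)) ->
  (forall x, f_ ^~ x @ \oo --> f x) ->
  m1.-integrable setT (EFin \o g) ->
  (forall k x, `|f_ k x| <= g x) ->
  \int[m1]_x f_ k x @[k --> \oo] --> \int[m1]_x f x.
Proof.
move=> mf cf ig fg.
have mf0 : measurable_fun setT f by exact:
  (@measurable_realfun.measurable_fun_cvg _ _ _ _ f_).
have fg0 x : `|f x| <= g x.
  have h : `|f_ k x| @[k --> \oo] --> `|f x| by exact: (cvg_norm (cf x)).
  rewrite -(cvg_lim (@Rhausdorff _) h); apply: limr_le; first by apply/cvg_ex;
    exists `|f x|.
  by near=> k; exact: fg.
have iff : m1.-integrable setT (EFin \o f).
  apply: le_integrable ig => //; first exact/measurable_EFinP.
  by move=> x _ /=; rewrite lee_fin (le_trans (fg0 _))// ler_norm.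
apply: fine_cvg; rewrite fineK; last exact: integrable_fin_num.
apply: (@dominated_cvg _ _ _ m1 setT measurableT (fun k x => (f_ k x)%:E) _
  (EFin \o g)) => //.
- by move=> k; exact/measurable_EFinP.
- by move=> x _; apply: cvg_EFin; [exact: nearW|exact: cf].
- by move=> k x _; rewrite /= lee_fin.
Unshelve. all: by end_near. Qed.

End generic_integration.

Section signed_integrals.
Context {R : realType}.
Local Notation mR := (measurableTypeR R).

Lemma integrable_affine n (y : 'rV[R]_n) (d : R) (f : n.-tuple mR -> R) : 0 < d ->
  (lebesgue_tuple n).-integrable setT (EFin \o f) ->
  (lebesgue_tuple n).-integrable setT (EFin \o (f \o affine_tuple y d)).
Proof.
move=> d0 /integrableP[mf foo]; apply/integrableP; split.
  by apply: (measurableT_comp mf); exact: measurable_affine.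
have := @ge0_integral_affine _ n y d (fun t => `|(f t)%:E|)%E d0.
move=> ->; [|exact: measurableT_comp|by []].
by apply: lte_mul_pinfty => //; rewrite lee_fin invr_ge0 exprn_ge0// ltW.
Qed.

Lemma Rintegral_affine n (y : 'rV[R]_n) (d : R) (f : n.-tuple mR -> R) : 0 < d ->
  (lebesgue_tuple n).-integrable setT (EFin \o f) ->
  \int[lebesgue_tuple n]_t f (affine_tuple y d t) = d ^- n *
    \int[lebesgue_tuple n]_t f t.
Proof.
move=> d0 iF.
have mf : measurable_fun setT (EFin \o f) by case/integrableP : iF.
rewrite /Rintegral -[d ^- n]/(fine (d ^- n)%:E) -fineM ?integrable_fin_num//.
congr fine; rewrite integralE [in RHS]integralE.
rewrite muleBr//; last first.
  by rewrite fin_num_adde_defr// integrable_pos_fin_num.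
congr (_ - _)%E.
- rewrite -(@ge0_integral_affine _ n y d (EFin \o f)^\+%E d0
    (measurable_funepos mf))//.
  by apply: eq_integral => t _; rewrite !funeposE.
- rewrite -(@ge0_integral_affine _ n y d (EFin \o f)^\-%E d0
    (measurable_funeneg mf))//.
  by apply: eq_integral => t _; rewrite !funenegE.
Qed.

End signed_integrals.

(** * Complex-valued functions *)

Section complex_numbers.
Context {R : realType}.
Local Notation Re := (@complex.Re R).
Local Notation Im := (@complex.Im R).
Implicit Types c z : R[i].

Lemma ReM c z : Re (c * z) = Re c * Re z - Im c * Im z.
Proof. by case: c z => [a b] [x y]. Qed.

Lemma ImM c z : Im (c * z) = Re c * Im z + Im c * Re z.
Proof. by case: c z => [a b] [x y]. Qed.

Lemma ReD c z : Re (c + z) = Re c + Re z.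
Proof. by case: c z => [a b] [x y]. Qed.

Lemma ReB c z : Re (c - z) = Re c - Re z.
Proof. by case: c z => [a b] [x y]. Qed.

Lemma ImB c z : Im (c - z) = Im c - Im z.
Proof. by case: c z => [a b] [x y]. Qed.

Lemma normcE z : normc z = Num.sqrt (Re z ^+ 2 + Im z ^+ 2).
Proof. by case: z. Qed.

Lemma normc_ge0 z : 0 <= normc z.
Proof. by rewrite normcE sqrtr_ge0. Qed.

Lemma sqr_normc z : normc z ^+ 2 = Re z ^+ 2 + Im z ^+ 2.
Proof. by rewrite normcE sqr_sqrtr// addr_ge0 ?sqr_ge0. Qed.

Lemma normRe_le z : `|Re z| <= normc z.
Proof. by rewrite normcE -sqrtr_sqr ler_wsqrtr// lerDl sqr_ge0. Qed.

Lemma normIm_le z : `|Im z| <= normc z.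
Proof. by rewrite normcE -sqrtr_sqr ler_wsqrtr// lerDr sqr_ge0. Qed.

Lemma ReM_le c z : Re (c * z) <= normc c * normc z.
Proof. by rewrite -normcM (le_trans (ler_norm _))// normRe_le. Qed.

(** Duality between a complex number and its real multiples: with this lemma, a
    bound on a complex integral follows from bounds on the real integrals
    Re (c * _), and no theory of complex-valued integration is needed. *)
Lemma normc_dual z : exists2 c, normc c <= 1 & Re (c * z) = normc z.
Proof.
have [z0|z0] := eqVneq (normc z) 0.
  exists 0; first by rewrite normc0.
  by rewrite mul0r z0.
exists (Re z / normc z -i* (Im z / normc z)).
  rewrite normcE /= sqrrN !expr_div_n -mulrDl -sqr_normc divff ?sqrtr1//.
  by rewrite expf_neq0.
rewrite ReM /= mulNr opprK.
by rewrite mulrAC -expr2 [X in _ + X]mulrAC -expr2 -mulrDl -sqr_normc expr2 mulfK.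
Qed.

Lemma le_normcD c z : normc (c + z) <= normc c + normc z.
Proof.
have [u u1 <-] := normc_dual (c + z).
rewrite mulrDr ReD; apply: lerD; apply: (le_trans (ReM_le _ _)).
  by rewrite ler_piMl ?normc_ge0.
by rewrite ler_piMl ?normc_ge0.
Qed.

Lemma normc_expi (t : R) : normc (expi t) = 1.
Proof. by rewrite normcE /= cos2Dsin2 sqrtr1. Qed.

Lemma expiD (s t : R) : expi (s + t) = expi s * expi t.
Proof. by apply/eqP; rewrite eq_complex /= cosD sinD addrC [X in _ == X]addrC;
  apply/andP; split; apply/eqP; ring. Qed.

Lemma Re_expi c (t : R) : Re (c * expi t) = Re c * cos t + - Im c * sin t.
Proof. by rewrite ReM /= mulNr. Qed.

End complex_numbers.

Section cmeasurable.
Context {R : realType} d (T : measurableType d).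
Implicit Types F G : T -> R[i].

(** Measurability is that of real and imaginary parts, in line with the notion of
    continuity [ccontinuous]. *)
Definition cmeasurable F := measurable_fun setT (fun t => complex.Re (F t)) /\
  measurable_fun setT (fun t => complex.Im (F t)).

Lemma cmeasurable_cst c : cmeasurable (fun=> c).
Proof. by []. Qed.

Lemma cmeasurableM F G : cmeasurable F -> cmeasurable G ->
  cmeasurable (fun t => F t * G t).
Proof.
move=> [F1 F2] [G1 G2]; split.
  under eq_fun do rewrite ReM.
  by apply: measurable_funB; exact: measurable_funM.
under eq_fun do rewrite ImM.
by apply: measurable_funD; exact: measurable_funM.
Qed.

Lemma cmeasurable_expi (f : T -> R) : measurable_fun setT f ->
  cmeasurable (fun t => expi (f t)).
Proof.
move=> mf; split.
  by apply: (measurableT_comp _ mf); apply: continuous_measurable_fun;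
    exact: continuous_cos.
by apply: (measurableT_comp _ mf); apply: continuous_measurable_fun;
  exact: continuous_sin.
Qed.

Lemma measurable_normc F : cmeasurable F ->
  measurable_fun setT (fun t => normc (F t)).
Proof.
move=> [F1 F2]; under eq_fun do rewrite normcE.
apply: measurableT_comp; first by apply: continuous_measurable_fun;
  exact: sqrt_continuous.
by apply: measurable_funD; exact: measurable_funX.
Qed.

End cmeasurable.

Lemma cmeasurable_comp {R : realType} d d' (T : measurableType d)
  (U : measurableType d')
   (F : T -> R[i]) (g : U -> T) : cmeasurable F -> measurable_fun setT g ->
   cmeasurable (fun u => F (g u)).
Proof. by move=> [F1 F2] mg; split;
  [exact: (measurableT_comp F1)|exact: (measurableT_comp F2)]. Qed.

(** * Continuous functions with compact support *)

Section compact_support.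
Context {R : realType} (n : nat).
Local Notation mR := (measurableTypeR R).
Local Notation Tn := (n.-tuple mR).
Local Notation mu := (@lebesgue_tuple R n).
Local Notation Re := (@complex.Re R).
Local Notation Im := (@complex.Im R).
Local Notation Rn := 'rV[R]_n.
Implicit Types (f g : Rn -> R[i]).

(** The space usually written C_c(R^n). *)
Definition Cc f := ccontinuous f /\ compactly_supported f.

Lemma cmeasurable_point f : ccontinuous f -> cmeasurable (fun t : Tn => f (point t)).
Proof. by move=> [c1 c2]; split; [exact: (measurable_point c1)|exact:
  (measurable_point c2)]. Qed.

Lemma continuous_normc f : ccontinuous f -> continuous (fun x => normc (f x)).
Proof.
move=> [c1 c2] x; under eq_fun do rewrite normcE.
apply: (@continuous_comp _ _ _ (fun x => Re (f x) ^+ 2 + Im (f x) ^+ 2) Num.sqrt);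
  last exact: sqrt_continuous.
apply: continuousD.
  exact: (@continuous_comp _ _ _ (fun x => Re (f x)) (fun y => y ^+ 2) x (c1 x)
    (@exprn_continuous _ _ _)).
exact: (@continuous_comp _ _ _ (fun x => Im (f x)) (fun y => y ^+ 2) x (c2 x)
  (@exprn_continuous _ _ _)).
Qed.

Lemma Cc_bounded f : Cc f -> exists2 M : R, 0 <= M & forall x, normc (f x) <= M.
Proof.
move=> [cf sf].
have [M [_ hM]] := compact_bounded
  (continuous_compact (continuous_subspaceT (continuous_normc cf)) sf).
exists (`|M| + 1) => [|x]; first by rewrite addr_ge0.
have [/eqP ->|fx] := boolP (f x == 0); first by rewrite normc0 addr_ge0.
apply: le_trans (ler_norm _) _; apply: (hM (`|M| + 1)).
  by rewrite (le_lt_trans (ler_norm _))// ltrDl.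
by exists x => //; exact: subset_closure.
Qed.

Lemma Cc_support f : Cc f -> exists2 B : R, 0 <= B &
  forall x, f x != 0 -> forall i, `|x 0 i| <= B.
Proof.
move=> [cf /compact_bounded [M [_ hM]]].
exists (`|M| + 1) => [|x fx i]; first by rewrite addr_ge0.
apply: (@le_trans _ _ `|x|).
  by rewrite [leRHS]/Num.norm/= mx_normrE;
    apply: (le_bigmax _ (fun ij : 'I_1 * 'I_n => `|x ij.1 ij.2|) (0, i)).
apply: hM; last exact: subset_closure.
by rewrite (le_lt_trans (ler_norm _))// ltrDl.
Qed.

(** A bounded function that vanishes outside a box, and boxes have finite measure. *)
Lemma Cc_integrable f : Cc f -> mu.-integrable setT
  (fun t => (normc (f (point t)))%:E).
Proof.
move=> nf.
have [M M0 fM] := Cc_bounded nf.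
have [B B0 fB] := Cc_support nf.
have mf := measurable_normc (cmeasurable_point nf.1).
pose box := [set t : Tn | forall i, `[- B, B]%classic (tnth t i : R)].
have mbox : measurable box.
  rewrite (_ : box = \big[setI/setT]_(i < n)
    ((fun t : Tn => tnth t i) @^-1` `[- B, B]%classic)).
    apply: bigsetI_measurable => i _.
    by rewrite -[X in measurable X]setTI; apply: measurable_tnth => //;
      exact: measurable_itv.
  rewrite -bigcap_seq; apply/seteqP; split => t /= tA i => [_|]; first exact: tA.
  by apply: tA => /=; rewrite mem_index_enum.
apply/integrableP; split; first exact/measurable_EFinP.
apply: (@le_lt_trans _ _ (\int[mu]_t (M%:E * (\1_box t)%:E))%E).
  apply: ge0_le_integral => //.
  - by apply: measurableT_comp => //; exact/measurable_EFinP.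
  - by apply/measurable_EFinP; apply: measurable_funM => //; exact: measurable_indic.
  move=> t _; rewrite gee0_abs ?lee_fin ?normc_ge0//.
  rewrite indicE; case: (boolP (t \in box)) => tb; first by rewrite mulr1.
  rewrite mulr0; suff /eqP -> : f (point t) == 0 by rewrite normc0.
  apply: contraNT tb => /fB h; rewrite inE /box /= => i.
  by have := h i; rewrite mxE in_itv/= -ler_norml.
rewrite ge0_integralZl//; last exact/measurable_EFinP/measurable_indic.
rewrite integral_indic// setIT.
apply: lte_mul_pinfty => //.
rewrite -ge0_fin_numE//.
have muE : mu box = (\prod_(i < n) lebesgue_measure
  (`[(- B)%R, B]%classic : set R))%E.
  by apply: (@lebesgue_tuple_box _ n (fun=> `[- B, B]%classic)) => i;
    exact: measurable_itv.
suff : mu box \is a fin_num by [].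
rewrite muE.
elim/big_ind : _ => //; first exact: fin_numM.
by move=> i _; rewrite lebesgue_measure_itv; case: ifP.
Qed.

End compact_support.

(** * The Fourier transform of a compactly supported function *)

Section fourier.
Context {R : realType} (n : nat).
Local Notation mR := (measurableTypeR R).
Local Notation Tn := (n.-tuple mR).
Local Notation mu := (@lebesgue_tuple R n).
Local Notation Re := (@complex.Re R).
Local Notation Im := (@complex.Im R).
Local Notation Rn := 'rV[R]_n.
Implicit Types (f g : Rn -> R[i]).

Lemma measurable_dotp2 : measurable_fun setT
  (fun z : Tn * Tn => dotp (point z.1) (point z.2)).
Proof.
apply: measurable_sum => i.
under eq_fun do rewrite !mxE.
by apply: measurable_funM; apply: measurableT_comp (measurable_tnth i) _;
  [exact: measurable_fst|exact: measurable_snd].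
Qed.

Lemma dotpC (x y : Rn) : dotp x y = dotp y x.
Proof. by apply: eq_bigr => i _; rewrite mulrC. Qed.

Lemma dotpDl (x y z : Rn) : dotp (x + y) z = dotp x z + dotp y z.
Proof. by rewrite /dotp -big_split; apply: eq_bigr => i _; rewrite mxE mulrDl. Qed.

Lemma dotpNl (x z : Rn) : dotp (- x) z = - dotp x z.
Proof. by rewrite /dotp -sumrN; apply: eq_bigr => i _; rewrite mxE mulNr. Qed.

Lemma measurable_dotp_point (x : Rn) : measurable_fun setT
  (fun t : Tn => dotp (point t) x).
Proof. by under eq_fun do rewrite dotpC; exact: measurable_dotp_tuple. Qed.

Lemma Cc_le_integrable f (h : Tn -> R) (A : R) : Cc f -> measurable_fun setT h ->
  (forall t, `|h t| <= A * normc (f (point t))) -> mu.-integrable setT (EFin \o h).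
Proof.
move=> nf mh hA.
apply: (@le_integrable _ _ _ mu setT measurableT _
  (fun t => A%:E * (normc (f (point t)))%:E)%E).
- exact/measurable_EFinP.
- by move=> t _ /=; rewrite lee_fin (le_trans (hA _))// ler_norm.
- by apply: integrableZl => //; exact: Cc_integrable.
Qed.

Lemma cmeasurable_kernel f xi : ccontinuous f ->
  cmeasurable (fun t : Tn => f (point t) * expi (- dotp (point t) xi)).
Proof.
move=> cf; apply: cmeasurableM; first exact: cmeasurable_point.
by apply: cmeasurable_expi; apply: measurableT_comp => //;
  exact: measurable_dotp_point.
Qed.

(** Multiplying by an arbitrary c before taking the real part gives access to both
    components of the transform by a single real integral. *)
Lemma Re_fourier f c xi : Cc f -> Re (c * fourier f xi) =
  \int[mu]_t Re (c * (f (point t) * expi (- dotp (point t) xi))).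
Proof.
move=> nf.
have [m1 m2] := cmeasurable_kernel xi nf.1.
have i1 : mu.-integrable setT (EFin \o
  (fun t => Re (f (point t) * expi (- dotp (point t) xi)))).
  apply: (@Cc_le_integrable f _ 1) => // t.
  by rewrite (le_trans (normRe_le _))// normcM normc_expi mulr1 mul1r.
have i2 : mu.-integrable setT (EFin \o
  (fun t => Im (f (point t) * expi (- dotp (point t) xi)))).
  apply: (@Cc_le_integrable f _ 1) => // t.
  by rewrite (le_trans (normIm_le _))// normcM normc_expi mulr1 mul1r.
rewrite ReM /= -(RintegralZl _ measurableT i1) -(RintegralZl _ measurableT i2).
rewrite -(RintegralB measurableT (integrableZl measurableT _ i1)
  (integrableZl measurableT _ i2)).
by apply: eq_Rintegral => t _; exact: esym (ReM _ _).
Qed.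

Lemma normc_fourier_le f xi : Cc f ->
  normc (fourier f xi) <= \int[mu]_t normc (f (point t)).
Proof.
move=> nf; have [c c1 <-] := normc_dual (fourier f xi).
have hle t : `|Re (c * (f (point t) * expi (- dotp (point t) xi)))| <= 1 * normc
  (f (point t)).
  rewrite (le_trans (normRe_le _))// !normcM normc_expi mulr1.
  by rewrite ler_wpM2r ?normc_ge0.
rewrite Re_fourier//; apply: le_Rintegral => //.
- apply: (@Cc_le_integrable f _ 1) => //.
  by have [] := cmeasurableM (@cmeasurable_cst _ _ Tn c) (cmeasurable_kernel xi nf.1).
- exact: Cc_integrable.
- by move=> t _; rewrite (le_trans (ler_norm _))// (le_trans (hle _))// mul1r.
Qed.

(** By Fubini-type measurability of parametric integrals; continuity of the
    transform is not involved. *)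
Lemma cmeasurable_fourier f : ccontinuous f ->
  cmeasurable (fun t : Tn => fourier f (point t)).
Proof.
move=> cf.
have [m1 m2] : cmeasurable (fun z : Tn * Tn =>
  f (point z.2) * expi (- dotp (point z.2) (point z.1))).
  apply: cmeasurableM.
    exact: (cmeasurable_comp (cmeasurable_point cf) (@measurable_snd _ _ Tn Tn)).
  apply: cmeasurable_expi; apply: measurableT_comp => //.
  under eq_fun do rewrite dotpC.
  exact: measurable_dotp2.
split; first exact: (measurable_Rintegral_snd mu m1).
exact: (measurable_Rintegral_snd mu m2).
Qed.

Lemma measurable_poisson d : 0 < d ->
  measurable_fun setT (fun t : Tn => poisson_kernel d (point t)).
Proof.
move=> d0; apply: measurable_prod => i _.
under eq_fun do rewrite mxE.
apply: (measurableT_comp (f := fun x : mR => 2 * d / (d ^+ 2 + (x : R) ^+ 2)) _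
  (measurable_tnth i)).
have cc : continuous (fun x : R => 2 * d / (d ^+ 2 + x ^+ 2)).
  move=> x; apply: cvgM; first exact: cvg_cst.
  apply: cvgV; first by rewrite gt_eqF// ltr_pwDl ?sqr_ge0// exprn_gt0.
  by apply: cvgD; [exact: cvg_cst|exact: exprn_continuous].
exact: continuous_measurable_fun.
Qed.

(** In this form the convergence of the kernel to 1 as d tends to 0 is clear. *)
Lemma laplaceE d (t : Tn) : laplace_kernel d t = expR
  (- (d * \sum_(i < n) `|tnth t i : R|)).
Proof. by rewrite /laplace_kernel -expR_sum sumrN mulr_sumr. Qed.

Lemma integral_laplace d : 0 < d ->
  (\int[mu]_t (laplace_kernel d t)%:E = ((2 / d) ^+ n)%:E)%E.
Proof.
move=> d0; have pq : 0 ^+ 2 + 0 ^+ 2 <= 1 ^+ 2 :> R by rewrite expr0n addr0 expr1n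
  ler01.
have := @integral_laplace_trig R n d 1 0 0 0 d0 ler01 pq.
rewrite mul1r mul0r addr0 => <-.
by apply: eq_integral => t _; rewrite !mul0r !addr0 mulr1.
Qed.

Lemma integrable_laplace d : 0 < d ->
  mu.-integrable setT (EFin \o @laplace_kernel R n d).
Proof.
move=> d0; apply/integrableP; split.
  by apply/measurable_EFinP; exact: measurable_laplace.
rewrite (_ : (\int[_]_(x in _) _ = ((2 / d) ^+ n)%:E)%E) ?ltry//.
rewrite -integral_laplace//; apply: eq_integral => t _.
by rewrite gee0_abs// lee_fin; exact/ltW/laplace_gt0.
Qed.

(** The constant normc b, added to make the integrand nonnegative, is subtracted
    again. *)
Lemma Rintegral_laplace_expi d (b : R[i]) (z : Rn) : 0 < d ->
  \int[mu]_t (laplace_kernel d t * Re (b * expi (dotp z (point t)))) = Re b *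
    poisson_kernel d z.
Proof.
move=> d0.
have il := integrable_laplace d0.
have b0 := normc_ge0 b.
have pq : Re b ^+ 2 + (- Im b) ^+ 2 <= normc b ^+ 2 by rewrite sqrrN sqr_normc.
have E1 := integral_laplace_trig z d0 b0 pq.
rewrite [X in \int[mu]_t X t](_ : _ =
  (fun t => laplace_kernel d t * (normc b + Re b * cos (dotp z (point t)) + - Im b
  * sin (dotp z (point t)))
   - normc b * laplace_kernel d t)); last first.
  by apply/funext => t; rewrite Re_expi; ring.
rewrite RintegralB//; last 2 first.
- apply: (@le_integrable _ _ _ mu setT measurableT _
    (fun t => (2 * normc b)%:E * (laplace_kernel d t)%:E)%E).
  + by apply/measurable_EFinP; exact: measurable_laplace_trig.
  + move=> t _ /=; rewrite lee_fin [leRHS]ger0_norm ?mulr_ge0//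
      ?(ltW (laplace_gt0 _ _))//.
    rewrite normrM ger0_norm ?(ltW (laplace_gt0 _ _))// mulrC ler_wpM2r
      ?(ltW (laplace_gt0 _ _))//.
    rewrite -addrA (le_trans (ler_normD _ _))// mulr2n mulrDl mul1r lerD//;
      first by rewrite ger0_norm.
    exact: normr_trig_le.
  + exact: integrableZl.
- exact: (integrableZl measurableT _ il).
rewrite RintegralZl// {1}/Rintegral E1 /=.
rewrite {1}/Rintegral integral_laplace//=; ring.
Qed.

(** The Poisson kernel is even and a dilation of its value at d = 1. *)
Lemma poisson_scale d (u : Rn) : 0 < d ->
  poisson_kernel d (- (d *: u)) = d ^- n * poisson_kernel 1 u.
Proof.
move=> d0; rewrite -exprVn -[X in _ ^+ X]card_ord -prodr_const -big_split /=.
apply: eq_bigr => i _; rewrite !mxE.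
have : 0 < 1 + u 0 i ^+ 2 by rewrite ltr_pwDl ?sqr_ge0.
move=> ?; field; rewrite !gt_eqF//= ?expr1n// .
by rewrite ltr_pwDl ?sqr_ge0// ?exprn_gt0// mulr_ge0 ?sqr_ge0.
Qed.

End fourier.

(** * Sums and products of compactly supported functions *)

Section Cc_closure.
Context {R : realType} (n : nat).
Local Notation Re := (@complex.Re R).
Local Notation Im := (@complex.Im R).
Local Notation Rn := 'rV[R]_n.
Implicit Types (f g : Rn -> R[i]).

Lemma continuous_funM (f g : Rn -> R) : continuous f -> continuous g ->
  continuous (fun x => f x * g x).
Proof. by move=> cf cg x; exact: (continuousM (cf x) (cg x)). Qed.

Lemma continuous_funB (f g : Rn -> R) : continuous f -> continuous g ->
  continuous (fun x => f x - g x).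
Proof. by move=> cf cg x; exact: (continuousB (cf x) (cg x)). Qed.

Lemma continuous_funD (f g : Rn -> R) : continuous f -> continuous g ->
  continuous (fun x => f x + g x).
Proof. by move=> cf cg x; exact: (continuousD (cf x) (cg x)). Qed.

Lemma ccontinuousM f g : ccontinuous f -> ccontinuous g ->
  ccontinuous (fun x => f x * g x).
Proof.
move=> [f1 f2] [g1 g2]; split.
  rewrite (_ : (fun x => _) = (fun x =>
    Re (f x) * Re (g x) - Im (f x) * Im (g x))); last first.
    by apply/funext => x; rewrite ReM.
  by apply: continuous_funB; exact: continuous_funM.
rewrite (_ : (fun x => _) = (fun x => Re (f x) * Im (g x) + Im (f x) * Re (g x)));
  last first.
  by apply/funext => x; rewrite ImM.
by apply: continuous_funD; exact: continuous_funM.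
Qed.

Lemma ccontinuousB f g : ccontinuous f -> ccontinuous g ->
  ccontinuous (fun x => f x - g x).
Proof.
move=> [f1 f2] [g1 g2]; split.
  rewrite (_ : (fun x => _) = (fun x => Re (f x) - Re (g x))); last first.
    by apply/funext => x; rewrite ReB.
  exact: continuous_funB.
rewrite (_ : (fun x => _) = (fun x => Im (f x) - Im (g x))); last first.
  by apply/funext => x; rewrite ImB.
exact: continuous_funB.
Qed.

Lemma ccontinuous_cst (c : R[i]) : ccontinuous (fun _ : Rn => c).
Proof. by split => x; exact: cst_continuous. Qed.

Lemma CcMl f g : Cc f -> ccontinuous g -> Cc (fun x => f x * g x).
Proof.
move=> [cf sf] cg; split; first exact: ccontinuousM.
apply: (subclosed_compact _ sf); first exact: closed_closure.
by apply: closure_subset => x /=; apply: contra => /eqP ->; rewrite mul0r.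
Qed.

Lemma CcB f g : Cc f -> Cc g -> Cc (fun x => f x - g x).
Proof.
move=> [cf sf] [cg sg]; split; first exact: ccontinuousB.
apply: (subclosed_compact _ (compactU sf sg)); first exact: closed_closure.
rewrite -closureU; apply: closure_subset => x /= fg.
have [f0|f0] := eqVneq (f x) 0; last by left.
by right; apply: contra fg => /eqP ->; rewrite f0 subr0.
Qed.

End Cc_closure.

(** * Fourier inversion *)

Section inversion.
Context {R : realType} (n : nat).
Local Notation mR := (measurableTypeR R).
Local Notation Tn := (n.-tuple mR).
Local Notation mu := (@lebesgue_tuple R n).
Local Notation Re := (@complex.Re R).
Local Notation Rn := 'rV[R]_n.
Implicit Types (f g : Rn -> R[i]).

Definition fourier_integrable f :=
  mu.-integrable setT (fun t => (normc (fourier f (point t)))%:E).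

Lemma continuous_ReM c f : ccontinuous f -> continuous (fun x => Re (c * f x)).
Proof. by move=> cf; exact: (ccontinuousM (ccontinuous_cst n c) cf).1. Qed.

(** The inversion integral damped by the Laplace kernel: unfolding the transform
    and exchanging the integrals makes the Poisson kernel centred at y appear,
    and the substitution x = y + d u rescales it. *)
Lemma mollified_inversion f c (y : Rn) (d : R) : Cc f -> fourier_integrable f ->
  0 < d ->
  \int[mu]_t (laplace_kernel d t * Re
    (c * (fourier f (point t) * expi (dotp y (point t))))) =
  \int[mu]_t (Re (c * f (y + d *: point t)) * poisson_kernel 1 (point t)).
Proof.
move=> nf fI d0.
have [mf1 mf2] := cmeasurable_point nf.1.
(* z.1 is the frequency and z.2 the space variable *)
pose F (z : Tn * Tn) := laplace_kernel d z.1 * Re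
  (c * (f (point z.2) * expi (dotp (y - point z.2) (point z.1)))).
have mF : measurable_fun setT F.
  apply: measurable_funM; first exact:
    (measurableT_comp (@measurable_laplace R n d) (@measurable_fst _ _ Tn Tn)).
  have [] // : cmeasurable (fun z : Tn * Tn =>
    (c * (f (point z.2) * expi (dotp (y - point z.2) (point z.1))))).
  apply: (@cmeasurableM _ _ _ (fun=> c)) => //; apply: cmeasurableM.
    exact: (cmeasurable_comp (cmeasurable_point nf.1) (@measurable_snd _ _ Tn Tn)).
  apply: cmeasurable_expi; under eq_fun do rewrite dotpDl dotpNl.
  apply: measurable_funB; first exact:
    (measurableT_comp (measurable_dotp_tuple y) (@measurable_fst _ _ Tn Tn)).
  under eq_fun do rewrite dotpC.
  exact: measurable_dotp2.
have FA x t : `|F (x, t)| <= laplace_kernel d x * (normc c * normc (f (point t))).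
  rewrite normrM ger0_norm ?(ltW (laplace_gt0 _ _))// ler_wpM2l
    ?(ltW (laplace_gt0 _ _))//.
  by rewrite (le_trans (normRe_le _))// !normcM normc_expi mulr1.
have iB : mu.-integrable setT (EFin \o (fun t : Tn => normc c * normc (f (point t)))).
  exact: (integrableZl measurableT _ (Cc_integrable nf)).
transitivity (\int[mu]_x \int[mu]_t F (x, t)).
  apply: eq_Rintegral => x _.
  have -> : c * (fourier f (point x) * expi (dotp y (point x))) =
    (c * expi (dotp y (point x))) * fourier f (point x) by ring.
  rewrite Re_fourier//.
  rewrite -RintegralZl//.
    apply: eq_Rintegral => t _; rewrite /F /= dotpDl dotpNl expiD;
      congr (_ * Re _); ring.
  apply: (@Cc_le_integrable _ _ f _ (normc c)) => //.
    by have [] := cmeasurableM (@cmeasurable_cst _ _ Tn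
      (c * expi (dotp y (point x)))) (cmeasurable_kernel (point x) nf.1).
  move=> t; rewrite (le_trans (normRe_le _))// !normcM !normc_expi !mulr1//.
rewrite (Rintegral_Fubini_le mF (integrable_laplace n d0) iB FA).
(* the inner integral, over frequencies, after the exchange *)
pose G (t : Tn) := Re (c * f (point t)) * poisson_kernel d (y - point t).
have iG : mu.-integrable setT (EFin \o G).
  apply: (@Cc_le_integrable _ _ f _ (normc c * (2 / d) ^+ n)) => //.
    apply: measurable_funM.
      by have [] := cmeasurableM (@cmeasurable_cst _ _ Tn c) (cmeasurable_point nf.1).
    apply: measurable_prod => i _.
    under eq_fun do rewrite !mxE.
    have cc : continuous (fun x : R => 2 * d / (d ^+ 2 + (y 0 i - x) ^+ 2)).
      move=> x; apply: cvgM; first exact: cvg_cst.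
      apply: cvgV; first by rewrite gt_eqF// ltr_pwDl ?sqr_ge0// exprn_gt0.
      apply: cvgD; first exact: cvg_cst.
      apply: (@continuous_comp _ _ _ (fun x => y 0 i - x) (fun x => x ^+ 2));
        last exact: exprn_continuous.
      by apply: cvgB; [exact: cvg_cst|exact: cvg_id].
    apply: (measurableT_comp (f := fun x : mR =>
      2 * d / (d ^+ 2 + (y 0 i - (x : R)) ^+ 2)) _ (measurable_tnth i)).
    exact: continuous_measurable_fun.
  move=> t; rewrite normrM [`|poisson_kernel _ _|]ger0_norm ?poisson_ge0// mulrAC.
  apply: ler_pM => //; first exact: poisson_ge0.
    by rewrite (le_trans (normRe_le _))// normcM.
  exact: poisson_le.
transitivity (\int[mu]_t G t).
  apply: eq_Rintegral => t _; rewrite /F /=.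
  by under eq_Rintegral do rewrite mulrA; rewrite Rintegral_laplace_expi.
have dn0 : d ^+ n != 0 by rewrite expf_neq0 ?gt_eqF.
apply: (mulfI (invr_neq0 dn0)).
rewrite -(Rintegral_affine y d0 iG) -RintegralZl//; last first.
  have := integrableZl measurableT (d ^+ n) (integrable_affine y d0 iG).
  congr (mu.-integrable _ _); apply/funext => t /=.
  rewrite /G point_affine opprD addNKr poisson_scale// -EFinM; congr EFin.
  by field.
apply: eq_Rintegral => t _.
rewrite /G point_affine opprD addNKr poisson_scale//; ring.
Qed.

(** Both sides of [mollified_inversion] converge by dominated convergence as d
    tends to 0: the left one because the transform is integrable, the right one
    because f is bounded and continuous at y. *)
Lemma fourier_inversion f c (y : Rn) : Cc f -> fourier_integrable f ->
  (2 * pi) ^+ n * Re (c * f y) =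
  \int[mu]_t Re (c * (fourier f (point t) * expi (dotp y (point t)))).
Proof.
move=> nf fI.
(* dominated convergence is for sequences, so d runs through 1/(k+1) *)
pose d_ (k : nat) : R := k.+1%:R^-1.
have d0 k : 0 < d_ k by rewrite invr_gt0.
have dcv : d_ k @[k --> \oo] --> (0 : R) by exact: cvg_harmonic.
pose s k := \int[mu]_t (laplace_kernel (d_ k) t * Re
  (c * (fourier f (point t) * expi (dotp y (point t))))).
have mh : measurable_fun setT (fun t : Tn =>
  Re (c * (fourier f (point t) * expi (dotp y (point t))))).
  have [] // : cmeasurable (fun t : Tn =>
    c * (fourier f (point t) * expi (dotp y (point t)))).
  apply: (@cmeasurableM _ _ _ (fun=> c)) => //; apply: cmeasurableM;
    first exact: cmeasurable_fourier nf.1.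
  by apply: cmeasurable_expi; exact: measurable_dotp_tuple.
have hb t : `|Re (c * (fourier f (point t) * expi (dotp y (point t))))| <= normc c
  * normc (fourier f (point t)).
  by rewrite (le_trans (normRe_le _))// !normcM normc_expi mulr1.
have s1 : s k @[k --> \oo] --> \int[mu]_t Re
  (c * (fourier f (point t) * expi (dotp y (point t)))).
  apply: (@dominated_cvg_Rintegral _ _ _ mu _ _
    (fun t => normc c * normc (fourier f (point t)))).
  - by move=> k; apply: measurable_funM => //; exact: measurable_laplace.
  - move=> t; rewrite -[X in _ --> X]mul1r; apply: cvgM; last exact: cvg_cst.
    under eq_fun do rewrite laplaceE.
    rewrite -expR0 -[X in expR X]oppr0
      -[X in - X](mul0r (\sum_(i < n) `|tnth t i : R|)).
    apply: (@cvg_comp _ _ _ (fun k => - (d_ k * \sum_(i < n) `|tnth t i : R|))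
      expR); last exact: continuous_expR.
    by apply: cvgN; apply: cvgM => //; exact: cvg_cst.
  - exact: (integrableZl measurableT _ fI).
  - move=> k t; rewrite normrM ger0_norm ?(ltW (laplace_gt0 _ _))//.
    apply: le_trans (hb t); rewrite ler_piMl// laplace_le1//.
have [M M0 fM] := Cc_bounded nf.
have p1 (t : Tn) : 0 <= poisson_kernel 1 (point t) by exact: poisson_ge0.
have ip : mu.-integrable setT (EFin \o (fun t : Tn => poisson_kernel 1 (point t))).
  apply/integrableP; split; first by apply/measurable_EFinP;
    exact: measurable_poisson.
  rewrite (_ : (\int[_]_(x in _) _ = ((2 * pi) ^+ n)%:E)%E) ?ltry//.
  rewrite -(@integral_poisson1 R n); apply: eq_integral => t _.
  by rewrite gee0_abs// lee_fin.
have s2 : s k @[k --> \oo] --> \int[mu]_t (Re (c * f y) * poisson_kernel 1 (point t)).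
  rewrite (_ : s = fun k => \int[mu]_t
    (Re (c * f (y + d_ k *: point t)) * poisson_kernel 1 (point t))); last first.
    by apply/funext => k; exact: mollified_inversion.
  apply: (@dominated_cvg_Rintegral _ _ _ mu _ _
    (fun t => (normc c * M) * poisson_kernel 1 (point t))).
  - move=> k; apply: measurable_funM; last exact: measurable_poisson.
    have [mc _] := cmeasurableM (@cmeasurable_cst _ _ Tn c) (cmeasurable_point nf.1).
    under eq_fun do rewrite -point_affine.
    exact: (measurableT_comp mc (measurable_affine y (d_ k))).
  - move=> t; apply: cvgM; last exact: cvg_cst.
    have ccf : continuous (fun x => Re (c * f x)).
      exact: continuous_ReM nf.1.
    have ycv : y + d_ k *: point t @[k --> \oo] --> y.
      rewrite -[X in _ --> X]addr0 -[X in _ + X](scale0r (point t)).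
      by apply: cvgD; [exact: cvg_cst|exact: cvgZr_tmp].
    exact: (@cvg_comp _ _ _ (fun k => y + d_ k *: point t) (fun x => Re (c * f x))
      \oo (nbhs y) (nbhs (Re (c * f y))) ycv (ccf y)).
  - exact: (integrableZl measurableT _ ip).
  - move=> k t; rewrite normrM [`|poisson_kernel _ _|]ger0_norm//.
    rewrite ler_wpM2r// (le_trans (normRe_le _))// normcM ler_wpM2l ?normc_ge0//.
rewrite -(cvg_unique (@Rhausdorff R) s2 s1) RintegralZl// mulrC; congr (_ * _).
by rewrite /Rintegral integral_poisson1.
Qed.

Lemma normc_le_fourier f (y : Rn) : Cc f -> fourier_integrable f ->
  (2 * pi) ^+ n * normc (f y) <= \int[mu]_t normc (fourier f (point t)).
Proof.
move=> nf fI; have [c c1 <-] := normc_dual (f y).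
rewrite fourier_inversion//.
have hb t : `|Re (c * (fourier f (point t) * expi (dotp y (point t))))| <= normc
  (fourier f (point t)).
  rewrite (le_trans (normRe_le _))// !normcM normc_expi mulr1.
  by rewrite ler_piMl ?normc_ge0.
apply: le_Rintegral => //.
- apply: le_integrable fI => //.
    apply/measurable_EFinP.
    have [] // : cmeasurable (fun t : Tn =>
      c * (fourier f (point t) * expi (dotp y (point t)))).
    apply: (@cmeasurableM _ _ _ (fun=> c)) => //; apply: cmeasurableM;
      first exact: cmeasurable_fourier nf.1.
    by apply: cmeasurable_expi; exact: measurable_dotp_tuple.
  by move=> t _ /=; rewrite lee_fin (le_trans (hb _))// ler_norm.
- by move=> t _; rewrite (le_trans (ler_norm _)).
Qed.

End inversion.

(** * The Euclidean norm *)

Section euclid.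
Context {R : realType} (n : nat).
Local Notation Rn := 'rV[R]_n.
Implicit Types x y : Rn.

Lemma dotpp_ge0 x : 0 <= dotp x x.
Proof. by apply: sumr_ge0 => i _; rewrite -expr2 sqr_ge0. Qed.

Lemma sqr_euclid x : euclid x ^+ 2 = dotp x x.
Proof. by rewrite sqr_sqrtr// dotpp_ge0. Qed.

Lemma coord_le_euclid x i : `|x 0 i| <= euclid x.
Proof.
rewrite -sqrtr_sqr ler_wsqrtr// /dotp (bigD1 i)//= -expr2 lerDl.
by apply: sumr_ge0 => j _; rewrite -expr2 sqr_ge0.
Qed.

(** Cauchy-Schwarz, by expanding the sum of the squares (x_i |y| - y_i |x|)^2. *)
Lemma dotp_le x y : dotp x y <= euclid x * euclid y.
Proof.
set a := euclid x; set b := euclid y.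
have a0 : 0 <= a by exact: sqrtr_ge0.
have b0 : 0 <= b by exact: sqrtr_ge0.
have : 0 <= \sum_i (x 0 i * b - y 0 i * a) ^+ 2 by apply: sumr_ge0 => i _;
  exact: sqr_ge0.
have -> : \sum_i (x 0 i * b - y 0 i * a) ^+ 2 = dotp x x * b ^+ 2 + dotp y y * a ^+
  2 - 2 * a * b * dotp x y.
  rewrite /dotp mulr_sumr !mulr_suml -big_split -sumrB /=.
  by apply: eq_bigr => i _; ring.
rewrite -!sqr_euclid -/a -/b => h.
(* when a or b is 0 all the products of coordinates vanish *)
have [ab0|ab0] := ltrP 0 (a * b).
  by rewrite -(ler_pM2l ab0); nra.
have ab : a * b = 0 by apply/eqP; rewrite eq_le ab0 mulr_ge0.
rewrite ab /dotp; apply: sumr_le0 => i _.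
have := coord_le_euclid x i; have := coord_le_euclid y i; rewrite -/a -/b => yb xa.
apply: le_trans (ler_norm _) _; rewrite normrM -ab.
by apply: ler_pM.
Qed.

Lemma euclidD x y : euclid (x + y) <= euclid x + euclid y.
Proof.
have a0 : 0 <= euclid x by exact: sqrtr_ge0.
have b0 : 0 <= euclid y by exact: sqrtr_ge0.
rewrite -(ler_pXn2r (ltn0Sn 1)) ?nnegrE ?addr_ge0 ?sqrtr_ge0// sqr_euclid.
rewrite !dotpDl ![dotp _ (x + y)]dotpC !dotpDl [dotp y x]dotpC -!sqr_euclid.
have := dotp_le x y; nra.
Qed.

End euclid.

(* Both compute to expressions in components once applied to an explicit complex
   number, which hides the algebraic laws. *)
Arguments fourier : simpl never.
Arguments normc : simpl never.

(** * The Fourier transform of differences and products *)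

Section convolution.
Context {R : realType} (n : nat).
Local Notation mR := (measurableTypeR R).
Local Notation Tn := (n.-tuple mR).
Local Notation mu := (@lebesgue_tuple R n).
Local Notation Re := (@complex.Re R).
Local Notation Rn := 'rV[R]_n.
Implicit Types (f g chi : Rn -> R[i]).

(** An inequality is enough for the norms, and duality spares the proof of the
    linearity of the complex transform. *)
Lemma normc_fourierB f g a xi : Cc f -> Cc g ->
  normc (fourier (fun x => f x - a * g x) xi) <= normc (fourier f xi) + normc a *
    normc (fourier g xi).
Proof.
move=> nf ng.
have nag : Cc (fun x => a * g x).
  by under eq_fun do rewrite mulrC; apply: CcMl => //; exact: ccontinuous_cst.
have nh : Cc (fun x => f x - a * g x) by exact: CcB.
have [c c1 <-] := normc_dual (fourier (fun x => f x - a * g x) xi).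
have I1 (u : R[i]) (k : Rn -> R[i]) : Cc k ->
  mu.-integrable setT (EFin \o (fun t : Tn =>
    Re (u * (k (point t) * expi (- dotp (point t) xi))))).
  move=> nk; apply: (@Cc_le_integrable _ _ k _ (normc u)) => //.
    by have [] := cmeasurableM (@cmeasurable_cst _ _ Tn u)
      (cmeasurable_kernel xi nk.1).
  by move=> t; rewrite (le_trans (normRe_le _))// !normcM normc_expi mulr1.
have -> : Re (c * fourier (fun x => f x - a * g x) xi) = Re (c * fourier f xi) - Re
  ((c * a) * fourier g xi).
  rewrite !Re_fourier// -(RintegralB measurableT (I1 _ _ nf) (I1 _ _ ng)).
  by apply: eq_Rintegral => t _; rewrite -ReB; congr Re; ring.
apply: lerD.
  by rewrite (le_trans (ReM_le _ _))// ler_piMl ?normc_ge0.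
rewrite (le_trans (ler_norm _))// normrN (le_trans (normRe_le _))// !normcM -mulrA.
by rewrite ler_piMl ?mulr_ge0 ?normc_ge0.
Qed.

(** The transform of a product is the convolution of the transforms up to
    (2 pi)^n: expand the second factor by the inversion formula and exchange the
    integrals. *)
Lemma Re_fourierM chi f c xi : Cc chi -> Cc f -> fourier_integrable f ->
  (2 * pi) ^+ n * Re (c * fourier (fun x => chi x * f x) xi) =
  \int[mu]_t Re (c * (fourier f (point t) * fourier chi (xi - point t))).
Proof.
move=> nc nf fI.
pose F (z : Tn * Tn) := Re ((c * (chi (point z.1) * expi (- dotp (point z.1) xi))) *
   (fourier f (point z.2) * expi (dotp (point z.1) (point z.2)))).
have mF : measurable_fun setT F.
  have [] // : cmeasurable (fun z : Tn * Tn =>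
    (c * (chi (point z.1) * expi (- dotp (point z.1) xi))) *
   (fourier f (point z.2) * expi (dotp (point z.1) (point z.2)))).
  apply: cmeasurableM.
    apply: (@cmeasurableM _ _ _ (fun=> c)) => //.
    exact: (cmeasurable_comp (cmeasurable_kernel xi nc.1)
      (@measurable_fst _ _ Tn Tn)).
  apply: cmeasurableM.
    exact: (cmeasurable_comp (cmeasurable_fourier nf.1) (@measurable_snd _ _ Tn Tn)).
  by apply: cmeasurable_expi; exact: measurable_dotp2.
have FA x t : `|F (x, t)| <= (normc c * normc (chi (point x))) * normc
  (fourier f (point t)).
  by rewrite (le_trans (normRe_le _))// !normcM !normc_expi !mulr1.
have iA := integrableZl measurableT (normc c) (Cc_integrable nc).
have nM : Cc (fun x => chi x * f x) by apply: CcMl => //; exact: nf.1.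
transitivity (\int[mu]_x \int[mu]_t F (x, t)).
  rewrite Re_fourier// -RintegralZl//; last first.
    apply: (@Cc_le_integrable _ _ _ _ (normc c) nM).
      by have [] := cmeasurableM (@cmeasurable_cst _ _ Tn c)
        (cmeasurable_kernel xi nM.1).
    by move=> t; rewrite (le_trans (normRe_le _))// !normcM normc_expi mulr1.
  apply: eq_Rintegral => x _; rewrite /F /= -fourier_inversion//.
  by congr (_ * Re _); ring.
rewrite (Rintegral_Fubini_le mF iA fI FA).
apply: eq_Rintegral => t _.
rewrite mulrA Re_fourier//; apply: eq_Rintegral => x _; rewrite /F /=; congr Re.
have -> : - dotp (point x) (xi - point t) = - dotp (point x) xi + dotp (point x)
  (point t).
  by rewrite [dotp _ (xi - _)]dotpC dotpDl dotpNl opprD opprK dotpC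
    [dotp (point t) _]dotpC.
rewrite expiD; ring.
Qed.

Definition sub_tuple (z : Tn * Tn) : Tn :=
  [tuple (tnth z.1 i : R) - tnth z.2 i | i < n].

Lemma point_sub z : point (sub_tuple z) = point z.1 - point z.2.
Proof. by apply/rowP => i; rewrite !mxE tnth_mktuple. Qed.

Lemma measurable_sub_tuple : measurable_fun setT sub_tuple.
Proof.
apply/measurable_fun_tnthP => i.
apply: (eq_measurable_fun (fun z : Tn * Tn => (tnth z.1 i : R) - tnth z.2 i)).
  by move=> t _ /=; rewrite tnth_mktuple.
apply: measurable_funB; apply: (measurableT_comp (measurable_tnth i));
  [exact: measurable_fst|exact: measurable_snd].
Qed.

Lemma normc_fourierM chi f xi : Cc chi -> Cc f -> fourier_integrable f ->
  (((2 * pi) ^+ n * normc (fourier (fun x => chi x * f x) (point xi)))%:E <=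
  \int[mu]_t (normc (fourier f (point t)) * normc
    (fourier chi (point xi - point t)))%:E)%E.
Proof.
move=> nc nf fI.
have [c c1 <-] := normc_dual (fourier (fun x => chi x * f x) (point xi)).
rewrite Re_fourierM//.
have mchi : cmeasurable (fun t : Tn => fourier chi (point xi - point t)).
  under eq_fun do rewrite -(point_sub (xi, _)).
  apply: (cmeasurable_comp (cmeasurable_fourier nc.1)).
  by apply: (measurableT_comp measurable_sub_tuple); exact: measurable_pair1.
have mf := cmeasurable_fourier nf.1.
have hle t : normc (fourier f (point t) * fourier chi (point xi - point t)) <=
    normc (fourier f (point t)) * \int[mu]_t normc (chi (point t)).
  by rewrite normcM ler_wpM2l ?normc_ge0// normc_fourier_le.
have iM : mu.-integrable setT (EFin \o
  (fun t => normc (fourier f (point t)) * normc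
  (fourier chi (point xi - point t)))).
  apply: (@le_integrable _ _ _ mu setT measurableT _
    (fun t => (normc (fourier f (point t)))%:E *
      (\int[mu]_t normc (chi (point t)))%:E)%E).
  - by apply/measurable_EFinP; apply: measurable_funM; exact: measurable_normc.
  - move=> t _; rewrite /= lee_fin ger0_norm ?mulr_ge0 ?normc_ge0// -normcM.
    by rewrite (le_trans (hle t))// ler_norm.
  - exact: integrableZr.
rewrite integral_EFin_Rintegral// lee_fin; apply: le_Rintegral => //.
- apply: le_integrable iM => //.
    apply/measurable_EFinP.
    have [] // : cmeasurable (fun t : Tn =>
      c * (fourier f (point t) * fourier chi (point xi - point t))).
    by apply: (@cmeasurableM _ _ _ (fun=> c)) => //; exact: cmeasurableM.
  move=> t _; rewrite /= lee_fin [leRHS]ger0_norm ?mulr_ge0 ?normc_ge0//.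
  apply: (le_trans (normRe_le _)); rewrite !normcM.
  by rewrite ler_piMl ?mulr_ge0 ?normc_ge0.
- move=> t _; rewrite (le_trans (ReM_le _ _))// !normcM.
  by rewrite ler_piMl ?mulr_ge0 ?normc_ge0.
Qed.

End convolution.

(** * The weighted norms *)

Section wnorm.
Context {R : realType} (n : nat) (w : R -> R).
Hypothesis hw : weight w.
Local Notation mR := (measurableTypeR R).
Local Notation Tn := (n.-tuple mR).
Local Notation mu := (@lebesgue_tuple R n).
Local Notation Rn := 'rV[R]_n.
Implicit Types (f g chi : Rn -> R[i]).

Let W (x : Rn) := w (euclid x).

Lemma weight_euclid_ge0 x : 0 <= W x.
Proof. by apply: hw.1; exact: sqrtr_ge0. Qed.

Lemma weight_euclidD x y : W (x + y) <= W x + W y.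
Proof.
have [_ [wle [_ [_ [wD _]]]]] := hw.
apply: (le_trans (wle _ _ (sqrtr_ge0 _) (euclidD x y))).
by apply: wD; exact: sqrtr_ge0.
Qed.

(** A monotone function is measurable; the weight is only monotone on the
    nonnegative reals, hence the truncation. *)
Lemma measurable_weight_euclid : measurable_fun setT (fun t : Tn => W (point t)).
Proof.
have [_ [wle _]] := hw.
have mw : measurable_fun setT (fun x : R => w (Num.max 0 x)).
  apply: nondecreasing_measurable => // x y xy; apply: wle;
    first by rewrite le_max lexx.
  by rewrite ge_max le_max lexx/= le_max xy orbT.
rewrite (_ : (fun t => _) = (fun t : Tn => w (Num.max 0 (euclid (point t)))));
  last first.
  by apply/funext => t; rewrite max_r// sqrtr_ge0.
apply: (measurableT_comp mw).
apply: measurableT_comp; first by apply: continuous_measurable_fun;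
  exact: sqrt_continuous.
apply: measurable_sum => i.
under eq_fun do rewrite !mxE.
by apply: measurable_funM; exact: measurable_tnth.
Qed.

Lemma measurable_exp_weight l : measurable_fun setT
  (fun t : Tn => expR (l * W (point t))).
Proof.
apply: (measurableT_comp (@measurable_expR R)).
by apply: measurable_funM => //; exact: measurable_weight_euclid.
Qed.

Lemma measurable_wnorm_integrand l f : ccontinuous f ->
  measurable_fun setT (fun t : Tn =>
    (normc (fourier f (point t)) * expR (l * W (point t)))%:E).
Proof.
move=> cf; apply/measurable_EFinP; apply: measurable_funM;
  last exact: measurable_exp_weight.
exact/measurable_normc/cmeasurable_fourier.
Qed.

Lemma wnorm_integrand_ge0 l f (x : Rn) :
  (0 <= (normc (fourier f x) * expR (l * W x))%:E)%E.
Proof. by rewrite lee_fin mulr_ge0 ?normc_ge0 ?expR_ge0. Qed.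

Lemma wnorm_ge0 l f : (0 <= wnorm w l f)%E.
Proof. by apply: integral_ge0 => t _; exact: wnorm_integrand_ge0. Qed.

Lemma le_wnorm k l f : ccontinuous f -> k <= l -> (wnorm w k f <= wnorm w l f)%E.
Proof.
move=> cf kl; apply: ge0_le_integral => //.
- by move=> t _; exact: wnorm_integrand_ge0.
- exact: measurable_wnorm_integrand.
- exact: measurable_wnorm_integrand.
- move=> t _; rewrite lee_fin ler_wpM2l ?normc_ge0// ler_expR ler_wpM2r//.
  exact: weight_euclid_ge0.
Qed.

Lemma fourier_L1_le_wnorm l f : ccontinuous f -> 0 <= l ->
  (\int[mu]_t (normc (fourier f (point t)))%:E <= wnorm w l f)%E.
Proof.
move=> cf l0; apply: ge0_le_integral => //.
- by move=> t _; rewrite lee_fin normc_ge0.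
- by apply/measurable_EFinP; exact/measurable_normc/cmeasurable_fourier.
- exact: measurable_wnorm_integrand.
- move=> t _; rewrite lee_fin ler_peMr ?normc_ge0// -expR0 ler_expR.
  by rewrite mulr_ge0// weight_euclid_ge0.
Qed.

Lemma wnorm_fourier_integrable l f : ccontinuous f -> 0 <= l ->
  (wnorm w l f < +oo)%E ->
  fourier_integrable f.
Proof.
move=> cf l0 foo; apply/integrableP; split.
  by apply/measurable_EFinP; exact/measurable_normc/cmeasurable_fourier.
apply: le_lt_trans foo; apply: le_trans (fourier_L1_le_wnorm cf l0).
rewrite le_eqVlt; apply/orP; left; apply/eqP.
by apply: eq_integral => t _; rewrite gee0_abs// lee_fin normc_ge0.
Qed.

(** The only bridge from seminorms to values; the weight is at least 1 under the
    exponential, and inversion does the rest. *)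
Lemma sup_le_wnorm l f x : Cc f -> 0 <= l ->
  (((2 * pi) ^+ n * normc (f x))%:E <= wnorm w l f)%E.
Proof.
move=> nf l0; have [foo|] := ltP (wnorm w l f) +oo%E; last first.
  by rewrite leye_eq => /eqP ->; rewrite leey.
have fI := wnorm_fourier_integrable nf.1 l0 foo.
apply: le_trans (fourier_L1_le_wnorm nf.1 l0).
by rewrite (integral_EFin_Rintegral fI) lee_fin normc_le_fourier.
Qed.

Lemma wnormB l f g a : Cc f -> Cc g ->
  (wnorm w l (fun x => (f x - a * g x)%R) <= wnorm w l f + (normc a)%:E * wnorm w l
    g)%E.
Proof.
move=> nf ng.
rewrite /wnorm -ge0_integralZl//; last 3 first.
- exact: measurable_wnorm_integrand ng.1.
- by move=> t _; exact: wnorm_integrand_ge0.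
- by rewrite lee_fin normc_ge0.
rewrite -ge0_integralD//; last 4 first.
- by move=> t _; exact: wnorm_integrand_ge0.
- exact: measurable_wnorm_integrand nf.1.
- by move=> t _; rewrite mule_ge0 ?lee_fin ?normc_ge0//; exact: wnorm_integrand_ge0.
- by apply: emeasurable_funM => //; exact: measurable_wnorm_integrand ng.1.
have nag : Cc (fun x => a * g x).
  by under eq_fun do rewrite mulrC; apply: CcMl => //; exact: ccontinuous_cst.
apply: ge0_le_integral => //.
- by move=> t _; exact: wnorm_integrand_ge0.
- by apply: measurable_wnorm_integrand; exact: (CcB nf nag).1.
- apply: emeasurable_funD; first exact: measurable_wnorm_integrand nf.1.
  by apply: emeasurable_funM => //; exact: measurable_wnorm_integrand ng.1.
- move=> t _; rewrite -EFinM -EFinD lee_fin mulrA -mulrDl ler_wpM2r ?expR_ge0//.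
  exact: normc_fourierB.
Qed.

(** Subadditivity gives e^{l w(xi)} <= e^{l w(eta)} e^{l w(xi - eta)}, so the
    weighted norm of a convolution is at most the product of the weighted norms,
    as for the unweighted L^1 norm. *)
Lemma wnormM l chi f : Cc chi -> Cc f -> 0 <= l -> (wnorm w l f < +oo)%E ->
  (((2 * pi) ^+ n)%:E * wnorm w l (fun x => (chi x * f x)%R) <= wnorm w l f * wnorm
    w l chi)%E.
Proof.
move=> nc nf l0 foo.
have fI := wnorm_fourier_integrable nf.1 l0 foo.
have nM : Cc (fun x => chi x * f x) by apply: CcMl => //; exact: nf.1.
have pi0 : 0 <= (2 * pi) ^+ n :> R by rewrite exprn_ge0// mulr_ge0// pi_ge0.
pose A (t : Tn) : \bar R := (normc (fourier f (point t)) * expR (l * W (point t)))%:E.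
pose B (t : Tn) : \bar R := (normc (fourier chi (point t)) * expR
  (l * W (point t)))%:E.
have mA : measurable_fun setT A by exact: measurable_wnorm_integrand nf.1.
have mB : measurable_fun setT B by exact: measurable_wnorm_integrand nc.1.
have A0 t : (0 <= A t)%E by exact: wnorm_integrand_ge0.
have B0 t : (0 <= B t)%E by exact: wnorm_integrand_ge0.
(* the weighted convolution integrand; z.2 is the convolution variable *)
pose F (z : Tn * Tn) := (A z.2 * B (sub_tuple z))%E.
have mF : measurable_fun setT F.
  apply: emeasurable_funM; first exact:
    (measurableT_comp mA (@measurable_snd _ _ Tn Tn)).
  exact: (measurableT_comp mB (@measurable_sub_tuple R n)).
have F0 z : (0 <= F z)%E by rewrite mule_ge0.
rewrite /wnorm -ge0_integralZl//; last 2 first.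
- exact: measurable_wnorm_integrand nM.1.
- by move=> t _; exact: wnorm_integrand_ge0.
apply: (@le_trans _ _ (\int[mu]_x \int[mu]_t F (x, t))%E).
  apply: ge0_le_integral => //.
  - by move=> t _; rewrite mule_ge0 ?lee_fin//; exact: wnorm_integrand_ge0.
  - by apply: emeasurable_funM => //; exact: measurable_wnorm_integrand nM.1.
  - exact: (@measurable_fun_fubini_tonelli_F _ _ _ _ _ mu F).
  move=> x _.
  rewrite -EFinM mulrA EFinM.
  apply: (@le_trans _ _ ((\int[mu]_t (normc (fourier f (point t)) *
     normc (fourier chi (point x - point t)))%:E) * (expR (l * W (point x)))%:E)%E).
    by apply: lee_wpmul2r; [rewrite lee_fin expR_ge0|exact: normc_fourierM].
  have mm : measurable_fun setT (fun t : Tn => (normc (fourier f (point t)) *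
     normc (fourier chi (point x - point t)))%:E).
    apply/measurable_EFinP; apply: measurable_funM; apply: measurable_normc.
      exact: cmeasurable_fourier nf.1.
    under eq_fun do rewrite -(point_sub (x, _)).
    apply: (cmeasurable_comp (cmeasurable_fourier nc.1)).
    by apply: (measurableT_comp (@measurable_sub_tuple R n)); exact: measurable_pair1.
  rewrite -ge0_integralZr//; last first.
    by move=> t _; rewrite lee_fin mulr_ge0 ?normc_ge0.
  apply: ge0_le_integral => //.
  - by move=> t _; rewrite -EFinM lee_fin !mulr_ge0 ?normc_ge0 ?expR_ge0.
  - by apply: emeasurable_funM.
  - by apply: (measurableT_comp mF); exact: measurable_pair1.
  move=> t _; rewrite /F /A /B /= -!EFinM lee_fin point_sub /=.
  rewrite mulrACA ler_wpM2l ?mulr_ge0 ?normc_ge0// -expRD -mulrDr ler_expR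
    ler_wpM2l//.
  rewrite (_ : W (point x) = W (point t + (point x - point t)));
    first exact: weight_euclidD.
  by rewrite addrC subrK.
rewrite fubini_tonelli//.
have B1 : (0 <= \int[mu]_t B t)%E by exact: integral_ge0.
have -> : (\int[mu]_t (normc (fourier f (point t)) * expR
  (l * w (euclid (point t))))%:E *
    \int[mu]_t (normc (fourier chi (point t)) * expR (l * w (euclid (point t))))%:E =
    \int[mu]_t (A t * \int[mu]_t B t))%E by rewrite ge0_integralZr.
apply: ge0_le_integral => //.
- by move=> t _; exact: integral_ge0.
- exact: (@measurable_fun_fubini_tonelli_G _ _ _ _ _ mu F).
- by apply: emeasurable_funM.
move=> t _.
have mBt : measurable_fun setT (fun x : Tn => B (sub_tuple (x, t))).
  apply: (measurableT_comp mB); apply: (measurableT_comp (@measurable_sub_tuple R n)).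
  exact: measurable_pair2.
rewrite [leLHS](ge0_integralZl mu measurableT mBt (fun x _ => B0 _) (A0 t)).
apply: lee_wpmul2l; first exact: A0.
have := @ge0_integral_affine _ n (- point t) 1 B ltr01 mB B0.
rewrite expr1n invr1 mul1e => <-.
rewrite le_eqVlt; apply/orP; left; apply/eqP.
apply: eq_integral => x _; congr B; apply: eq_from_tnth => i.
by rewrite !tnth_mktuple !mxE mul1r addrC.
Qed.

End wnorm.

(** * Interpolation between weighted norms *)

Section interpolation.
Context {R : realType} (n : nat) (w : R -> R).
Hypothesis hw : weight w.
Local Notation mR := (measurableTypeR R).
Local Notation Tn := (n.-tuple mR).
Local Notation mu := (@lebesgue_tuple R n).
Local Notation Rn := 'rV[R]_n.
Implicit Types (f g chi : Rn -> R[i]).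

(** As w(t) / ln (1 + t) tends to infinity, a w(t) eventually exceeds m ln (1 + t);
    the constant absorbs the bounded range. *)
Lemma exp_weight_le_power a m : 0 < a -> exists2 C : R, 0 <= C &
  forall t, 0 <= t -> expR (- (a * w t)) <= C * ((1 + t) ^+ m)^-1.
Proof.
move=> a0; have [w0 [_ [_ [_ [_ [_ wlim]]]]]] := hw.
have := (cvgryPge _).1 wlim (m%:R / a).
move=> [M [_ hM]].
pose T := Num.max M 0.
have T0 : 0 <= T by rewrite le_max lexx orbT.
exists ((1 + T) ^+ m) => [|t t0]; first by rewrite exprn_ge0// addr_ge0.
have t1 : 0 < 1 + t by rewrite ltr_pwDl.
rewrite ler_pdivlMr ?exprn_gt0//.
have [tT|tT] := leP t T.
  rewrite -[leRHS]mul1r; apply: ler_pM; rewrite ?expR_ge0 ?exprn_ge0 ?(ltW t1)//.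
    by rewrite -expR0 ler_expR oppr_le0 mulr_ge0 ?(ltW a0)// w0.
  by rewrite lerXn2r ?nnegrE ?(ltW t1) ?addr_ge0// lerD2l.
have /andP[Mt t0'] : (M < t) && (0 < t) by rewrite -gt_max.
have := hM _ Mt; rewrite ler_pdivlMr ?ln_gt0 ?ltrDl// mulrAC ler_pdivrMr// => h.
apply: (@le_trans _ _ 1); last by rewrite exprn_ege1// lerDl.
rewrite -[X in _ * X ^+ _](lnK t1) -expRM_natr -expRD -[leRHS]expR0 ler_expR.
lra.
Qed.

(** The power 2n beats the product of the n factors 1 + x_i^2, each of which is at
    most (1 + |x|)^2. *)
Lemma exp_weight_le_poisson a : 0 < a -> exists2 C : R, 0 <= C &
  forall x : Rn, expR (- (a * w (euclid x))) <= C * poisson_kernel 1 x.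
Proof.
move=> a0; have [C C0 hC] := exp_weight_le_power (2 * n) a0.
exists C => // x; apply: le_trans (hC _ (sqrtr_ge0 _)) _; rewrite ler_wpM2l//.
have e0 : 0 <= euclid x by exact: sqrtr_ge0.
rewrite exprM -exprVn -[X in _ ^+ X]card_ord -prodr_const; apply: ler_prod => i _.
have x0 : 0 < 1 + x 0 i ^+ 2 by rewrite ltr_pwDl ?sqr_ge0.
rewrite expr1n mulr1 invr_ge0 sqr_ge0/= (@le_trans _ _ (1 + x 0 i ^+ 2)^-1)//.
  rewrite lef_pV2 ?posrE ?exprn_gt0// ?ltr_pwDl//.
  have : x 0 i ^+ 2 <= euclid x ^+ 2.
    rewrite -(real_normK (num_real (x 0 i))) lerXn2r ?nnegrE//.
    exact: coord_le_euclid.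
  rewrite -/(euclid x) sqrrD expr1n mul1r mulr2n; lra.
by rewrite ler_peMl ?invr_ge0 ?(ltW x0)// ler1n.
Qed.

Lemma integral_exp_weight a : 0 < a -> exists2 C : R, 0 <= C &
  (\int[mu]_t (expR (- (a * w (euclid (point t)))))%:E <= C%:E)%E.
Proof.
move=> a0; have [C C0 hC] := exp_weight_le_poisson a0.
have pi0 : 0 <= (2 * pi) ^+ n :> R by rewrite exprn_ge0// mulr_ge0// pi_ge0.
have mp : measurable_fun setT (fun t : Tn => (poisson_kernel 1 (point t))%:E).
  by apply/measurable_EFinP; exact: measurable_poisson.
exists (C * (2 * pi) ^+ n); first by rewrite mulr_ge0.
have p0 (t : Tn) : (0 <= (poisson_kernel 1 (point t))%:E)%E by rewrite lee_fin
  poisson_ge0.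
have C0e : (0 <= C%:E)%E by rewrite lee_fin.
rewrite EFinM -integral_poisson1 -(ge0_integralZl mu measurableT mp
  (fun t _ => p0 t) C0e).
have me : measurable_fun setT (fun t : Tn =>
  (expR (- (a * w (euclid (point t)))))%:E).
  by apply/measurable_EFinP; under eq_fun do rewrite -mulNr;
    exact: measurable_exp_weight.
have e0 (t : Tn) : (0 <= (expR (- (a * w (euclid (point t)))))%:E)%E by rewrite
  lee_fin expR_ge0.
apply: (ge0_le_integral mu measurableT (fun t _ => e0 t) me).
- by apply: emeasurable_funM.
- by move=> t _; rewrite -EFinM lee_fin.
Qed.

(** Write X as sqrt X * sqrt X, bound one factor by sqrt D, and apply the
    arithmetic-geometric inequality to sqrt X e^{(h + a/2) v} and e^{- a v / 2}. *)
Lemma interpolation_pointwise (X D h a v : R) : 0 <= X -> X <= D ->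
  X * expR (h * v) <= Num.sqrt D * (X * expR ((2 * h + a) * v) + expR (- (a * v))).
Proof.
move=> X0 XD.
have D0 : 0 <= D by exact: le_trans XD.
set u := Num.sqrt X; have u0 : 0 <= u by exact: sqrtr_ge0.
have uD : u <= Num.sqrt D by rewrite ler_wsqrtr.
have uX : X = u * u by rewrite -expr2 sqr_sqrtr.
set p := expR ((h + a / 2) * v); set q := expR (- (a / 2 * v)).
have -> : expR (h * v) = p * q by rewrite -expRD; congr expR; field.
have -> : expR ((2 * h + a) * v) = p * p by rewrite -expRD; congr expR; field.
have -> : expR (- (a * v)) = q * q by rewrite -expRD; congr expR; field.
rewrite uX -mulrA; apply: ler_pM => //;
  first by rewrite mulr_ge0// mulr_ge0// expR_ge0.
have := sqr_ge0 (u * p - q); have p0 : 0 <= p := expR_ge0 _; have q0 : 0 <= q :=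
  expR_ge0 _.
have := mulr_ge0 (mulr_ge0 u0 p0) q0; nra.
Qed.

(** A uniform bound on the transform improves any weighted norm at the cost of a
    square root and of an exponent more than twice as large. *)
Lemma wnorm_interpolation g (D h a : R) : Cc g -> 
  (forall xi, normc (fourier g xi) <= D) ->
  (wnorm w h g <= (Num.sqrt D)%:E *
    (wnorm w (2 * h + a) g + \int[mu]_t (expR (- (a * w (euclid (point t)))))%:E))%E.
Proof.
move=> ng gD.
have me : measurable_fun setT (fun t : Tn =>
  (expR (- (a * w (euclid (point t)))))%:E).
  by apply/measurable_EFinP; under eq_fun do rewrite -mulNr;
    exact: measurable_exp_weight.
have mg k := measurable_wnorm_integrand hw k ng.1.
have g0 k t := wnorm_integrand_ge0 w k g t.
have e0 (t : Tn) : (0 <= (expR (- (a * w (euclid (point t)))))%:E)%E by rewrite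
  lee_fin expR_ge0.
have ms := emeasurable_funD (mg (2 * h + a)) me.
have D0 : (0 <= (Num.sqrt D)%:E)%E by rewrite lee_fin sqrtr_ge0.
rewrite /wnorm -(ge0_integralD mu measurableT (fun t _ => g0 _ _) (mg _)
  (fun t _ => e0 t) me).
rewrite -(ge0_integralZl mu measurableT ms (fun t _ => adde_ge0 (g0 _ _) (e0 t)) D0).
apply: (ge0_le_integral mu measurableT (fun t _ => g0 _ _) (mg _)).
  by apply: emeasurable_funM.
move=> t _; rewrite -EFinD -EFinM lee_fin.
by apply: interpolation_pointwise => //; exact: normc_ge0.
Qed.

End interpolation.

(** * Local seminorms *)

Section local_norms.
Context {R : realType} (n : nat) (s : ultra) (w : R -> R).
Hypothesis hw : weight w.
Local Notation mR := (measurableTypeR R).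
Local Notation mu := (@lebesgue_tuple R n).
Local Notation Rn := 'rV[R]_n.
Implicit Types (f g chi psi : Rn -> R[i]).
Local Notation supp chi := (closure [set x | chi x != 0%R]).

Lemma testfun_Cc f : testfun s w f -> Cc f.
Proof. by move=> [? [? _]]. Qed.

Lemma wnormB_lty l f g a : Cc f -> Cc g -> (wnorm w l f < +oo)%E ->
  (wnorm w l g < +oo)%E ->
  (wnorm w l (fun x => (f x - a * g x)%R) < +oo)%E.
Proof.
move=> nf ng fl gl; apply: (le_lt_trans (wnormB hw l a nf ng)).
have a0 : (0 <= (normc a)%:E)%E by rewrite lee_fin normc_ge0.
exact: (lte_add_pinfty fl (lte_mul_pinfty a0 isT gl)).
Qed.

Lemma testfunB f g a : testfun s w f -> testfun s w g ->
  testfun s w (fun x => f x - a * g x).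
Proof.
move=> tf tg; have nf := testfun_Cc tf; have ng := testfun_Cc tg.
have nag : Cc (fun x => a * g x).
  by under eq_fun do rewrite mulrC; apply: CcMl => //; exact: ccontinuous_cst.
have [c1 c2] := CcB nf nag.
split => //; split => //.
move: tf tg => [_ [_ tf]] [_ [_ tg]].
case: s tf tg => [tf tg l l0|[l1 l10 fl] [l2 l20 gl]].
  by apply: wnormB_lty => //; [exact: tf|exact: tg].
exists (Num.min l1 l2); first by rewrite lt_min l10.
apply: wnormB_lty => //.
  by apply: le_lt_trans fl; apply: (le_wnorm hw nf.1); rewrite ge_min lexx.
by apply: le_lt_trans gl; apply: (le_wnorm hw ng.1); rewrite ge_min lexx orbT.
Qed.

Lemma Ck_subr_cst k (g : Rn -> R) a : Ck k g -> Ck k (fun x => g x - a).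
Proof.
have cB h : continuous h -> continuous (fun x : Rn => h x - a).
  by move=> ch; apply: continuous_funB => // x; exact: cst_continuous.
elim: k g => [|k IHk] g [cg]; first by move=> _; split => //; exact: cB.
move=> dg; split=> [|i]; first exact: cB.
have [dgi Cgi] := dg i.
split=> [x|]; first by apply: derivableB => //; exact: derivable_cst.
rewrite (_ : 'D_(delta_mx 0 i) _ = 'D_(delta_mx 0 i) g)//.
apply/funext => x; rewrite [LHS](@deriveB _ _ _ g (cst a))//.
by rewrite derive_cst subr0.
Qed.

Lemma smooth_subr_cst f c : smooth f -> smooth (fun x => f x - c).
Proof.
move=> sf k; have [C1 C2] := sf k; split.
  by under eq_fun do rewrite ReB; exact: Ck_subr_cst.
by under eq_fun do rewrite ImB; exact: Ck_subr_cst.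
Qed.

Lemma ultrasmooth_subr_cst f c : ultrasmooth s w f ->
  ultrasmooth s w (fun x => f x - c).
Proof.
move=> [sf tf]; split; first exact: smooth_subr_cst.
move=> psi tpsi.
rewrite (_ : (fun x => _) = (fun x => psi x * f x - c * psi x)); last first.
  by apply/funext => x; ring.
exact: (@testfunB (fun x => psi x * f x) psi c (tf _ tpsi) tpsi).
Qed.

(** Every competing cutoff is 1 at x, so the bound holds for each of them. *)
Lemma sup_le_local_norm (K : set Rn) l g x : ultrasmooth s w g -> 0 <= l -> K x ->
  (((2 * pi) ^+ n * normc (g x))%:E <= local_norm s w K l g)%E.
Proof.
move=> [_ tg] l0 Kx; apply: le_ereal_inf_tmp => _ [psi [tpsi psi1] <-].
rewrite -[g x]mul1r -(psi1 _ Kx).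
exact: (sup_le_wnorm hw x (testfun_Cc (tg _ tpsi)) l0).
Qed.

(** A cutoff psi that is 1 on the support of chi satisfies chi g = chi (psi g);
    the constant B does not depend on psi, nor on g, and this is what frees the
    estimates for nets from cutoffs depending on eps. *)
Lemma wnorm_le_local_norm chi l : Cc chi -> 0 <= l -> (wnorm w l chi < +oo)%E ->
  exists2 B : R, 0 <= B & forall g (M : R), ultrasmooth s w g ->
  (local_norm s w (supp chi) l g <= M%:E)%E ->
  (wnorm w l (fun x => (chi x * g x)%R) <= (B * (M + 1))%:E)%E.
Proof.
move=> nchi l0 chil.
have Cn0 : 0 < (2 * pi) ^+ n :> R by rewrite exprn_gt0// mulr_gt0// pi_gt0.
have X0 := wnorm_ge0 w l chi.
have Xfin : wnorm w l chi \is a fin_num by rewrite ge0_fin_numE.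
exists (fine (wnorm w l chi) / (2 * pi) ^+ n).
  by rewrite divr_ge0 ?(ltW Cn0)// fine_ge0.
move=> g M [_ tg] gM.
have M1 : (local_norm s w (supp chi) l g < (M + 1)%:E)%E.
  by apply: le_lt_trans gM _; rewrite lte_fin ltrDl.
have [_ [psi [tpsi psi1] <-] psiM] := ereal_inf_lt M1.
have npg := testfun_Cc (tg _ tpsi).
rewrite (_ : (fun x => chi x * g x) = (fun x => chi x * (psi x * g x))); last first.
  apply/funext => x; have [->|chix] := eqVneq (chi x) 0; first by rewrite !mul0r.
  by rewrite psi1 ?mul1r//; exact: subset_closure.
have := wnormM hw nchi npg l0 (lt_trans psiM (ltry _)).
rewrite -[wnorm w l chi]fineK// => h.
have Ce0 : (0%:E < ((2 * pi) ^+ n : R)%:E)%E by rewrite lte_fin.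
have Cef : ((2 * pi) ^+ n : R)%:E \is a fin_num by [].
rewrite -(lee_pmul2l Cef Ce0).
apply: (le_trans h); rewrite -EFinM.
rewrite (_ : (_ * (_ * _))%R = (M + 1) * fine (wnorm w l chi)); last by field;
  rewrite gt_eqF.
rewrite EFinM; apply: lee_wpmul2r; first by rewrite lee_fin fine_ge0.
exact: ltW.
Qed.

(** The estimate that converts uniform smallness into smallness of seminorms.  The
    constant A is uniform in g, c, D and M, so that it applies to nets. *)
Lemma local_norm_subr_cst_le (K : set Rn) chi (h a : R) : 0 <= h -> 0 < a ->
  testfun s w chi -> (forall x, K x -> chi x = 1) ->
    (wnorm w (2 * h + a) chi < +oo)%E ->
  exists2 A : R, 0 <= A & forall g c (D M : R), ultrasmooth s w g -> 0 <= D ->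
    0 <= M ->
   (forall x, supp chi x -> normc (g x - c) <= D) ->
   (local_norm s w (supp chi) (2 * h + a) g <= M%:E)%E ->
   (local_norm s w K h (fun x => (g x - c)%R) <=
     (A * Num.sqrt D * (1 + M + normc c))%:E)%E.
Proof.
move=> h0 a0 tchi chi1 chil.
have nchi := testfun_Cc tchi.
have l0 : 0 <= 2 * h + a by rewrite addr_ge0 ?mulr_ge0// ltW.
have [B B0 hB] := wnorm_le_local_norm nchi l0 chil.
have [E E0 hE] := integral_exp_weight n hw a0.
pose X := fine (wnorm w (2 * h + a) chi).
have X0 : 0 <= X by apply: fine_ge0; exact: wnorm_ge0.
have Xfin : wnorm w (2 * h + a) chi = X%:E by rewrite fineK// ge0_fin_numE//
  wnorm_ge0.
pose I := \int[mu]_t normc (chi (point t)).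
have I0 : 0 <= I by apply: Rintegral_ge0 => t _; exact: normc_ge0.
exists (Num.sqrt I * (B + X + E)); first by rewrite mulr_ge0 ?sqrtr_ge0// !addr_ge0.
move=> g c D M ug D0 M0 gD gM.
have tgc : testfun s w (fun x => chi x * (g x - c)).
  exact: ((ultrasmooth_subr_cst c ug).2 _ tchi).
have ngc := testfun_Cc tgc.
have ng := testfun_Cc (ug.2 _ tchi).
apply: (@le_trans _ _ (wnorm w h (fun x => chi x * (g x - c)))).
  by apply: ereal_inf_lbound; exists chi.
have FD xi : normc (fourier (fun x => chi x * (g x - c)) xi) <= I * D.
  apply: (le_trans (normc_fourier_le xi ngc)).
  have ichi := Cc_integrable nchi.
  rewrite mulrC -(RintegralZl D measurableT ichi).
  apply: (le_Rintegral measurableT (Cc_integrable ngc)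
    (integrableZl measurableT D ichi)).
  move=> t _; rewrite normcM mulrC.
  have [->|chit] := eqVneq (chi (point t)) 0; first by rewrite normc0 !mulr0.
  by rewrite ler_wpM2r ?normc_ge0// gD//; exact: subset_closure.
apply: (le_trans (wnorm_interpolation hw h a ngc FD)).
rewrite sqrtrM// (_ : Num.sqrt I * (B + X + E) * Num.sqrt D * (1 + M + normc c) =
  (Num.sqrt I * Num.sqrt D) * ((B + X + E) * (1 + M + normc c))); last by ring.
rewrite [leRHS]EFinM; apply: lee_wpmul2l;
  first by rewrite lee_fin mulr_ge0 ?sqrtr_ge0.
apply: (@le_trans _ _ ((B * (M + 1))%:E + (normc c)%:E * X%:E + E%:E)%E).
  apply: leeD; last exact: hE.
  rewrite (_ : (fun x => chi x * (g x - c)) = (fun x => chi x * g x - c * chi x));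
    last first.
    by apply/funext => x; ring.
  apply: (le_trans (wnormB hw (2 * h + a) c ng nchi)).
  by rewrite Xfin; apply: leeD; [exact: hB|exact: lexx].
rewrite -EFinM -!EFinD lee_fin.
have c0 := normc_ge0 c.
have := mulr_ge0 B0 c0; have := mulr_ge0 X0 M0; have := mulr_ge0 E0 M0; have :=
  mulr_ge0 E0 c0.
nra.
Qed.

End local_norms.

(** * Uniformity of translation invariance *)

(* The join of completeness and norm on row vectors, under which the Baire
   category theorem applies. *)
HB.instance Definition _ (R : realType) n := NormedModule.on 'rV[R]_n.

Section translations.
Context {R : realType} (n : nat).
Local Notation Rn := 'rV[R]_n.

(** If no A i contained a ball, their complements would be dense open sets with
    empty intersection. *)
Lemma baire_ball (A : nat -> set Rn) : (forall i, closed (A i)) ->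
  (forall x, exists i, A i x) ->
  exists i (x0 : Rn), exists2 r : R, 0 < r & forall y : Rn,
    (forall j, `|x0 0 j - y 0 j| < r) -> A i y.
Proof.
move=> cA covA; apply: contrapT => noball.
have dA i : open (~` A i) /\ dense (~` A i).
  split; first by rewrite openC.
  move=> O [x Ox] oO; apply: contrapT => OA.
  apply: noball; exists i, x.
  have /rV_nearP[r r0 rO] : \forall y \near x, O y by exact: open_nbhs_nbhs.
  exists r => // y /rO Oy; apply: contrapT => nAy; apply: OA; by exists y.
have [x [_ Ax]] := @Baire R 'rV[R]_n _ dA setT (ex_intro _ 0 I) openT.
have [i Aix] := covA x.
exact: (Ax i I).
Qed.

Lemma closed_normc_le (g : Rn -> R[i]) (c : R[i]) (d : R) : ccontinuous g ->
  closed [set x | normc (g x - c) <= d].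
Proof.
move=> cg; have cgc := continuous_normc (ccontinuousB cg (ccontinuous_cst _ c)).
apply: (@topology_structure.preimage_closed _ _ (fun x => normc (g x - c))
  [set y | y <= d]); last exact: closed_le.
by move=> x _; exact: cgc.
Qed.

Lemma at_right0P (P : R -> Prop) : (\forall e \near 0^'+, P e) <->
  exists2 d : R, 0 < d & forall e, 0 < e < d -> P e.
Proof.
split.
  rewrite near_withinE => /nbhs_ballP[d /= d0 dP]; exists d => // e /andP[e0 ed].
  by apply: dP => //=; rewrite /ball/= sub0r normrN gtr0_norm.
move=> [d d0 dP]; near=> e; apply: dP; apply/andP; split => //.
Unshelve. all: by end_near. Qed.

(** The rates r m increase with m, which covers both cases at once: a constant
    family in the Beurling case, where the exponent is prescribed, and
    e^{- w / (m + 1)} in the Roumieu case, where it may degrade from one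
    translation to the next.  Choosing m and eps together, along a product
    filter, leaves the extraction of a finite subcover to the compactness of K. *)
Lemma translation_invariant_sup (f : R -> Rn -> R[i]) (r : nat -> R -> R) :
  (forall e, 0 < e < 1 -> ccontinuous (f e)) ->
  (forall e m m', 0 < e < 1 -> (m <= m')%N -> r m e <= r m' e) ->
  (forall x (K : set Rn), compact K -> exists m, \forall e \near 0^'+,
     forall y, K y -> normc (f e (y + x) - f e y) <= r m e) ->
  forall K : set Rn, compact K -> exists m, \forall e \near 0^'+,
     forall y, K y -> normc (f e y - f e 0) <= 2 * r m e.
Proof.
move=> cf rle fr.
(* m bounds both the threshold on eps and the index of the rate *)
pose A m := [set x | forall e, 0 < e < m.+1%:R^-1 -> normc (f e x - f e 0) <= r m e].
have lt1 m (e : R) : 0 < e < m.+1%:R^-1 -> 0 < e < 1.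
  by move=> /andP[-> em]; rewrite (lt_le_trans em)// invf_le1// ler1n.
have cA m : closed (A m).
  rewrite (_ : A m = \bigcap_(e in [set e : R | 0 < e < m.+1%:R^-1])
    [set x | normc (f e x - f e 0) <= r m e])//.
  by apply: closed_bigI => e /lt1 e1; exact/closed_normc_le/cf.
have covA x : exists m, A m x.
  have [m /at_right0P[d d0 hd]] := fr x [set 0] (@compact_set1 _ _).
  have [N _ /(_ N (leqnn N)) /= Nd] := near_infty_natSinv_lt (PosNum d0).
  exists (maxn m N) => e he.
  have e1 := lt1 _ _ he.
  apply: (@le_trans _ _ (r m e)); last by apply: rle => //; exact: leq_maxl.
  rewrite -[X in f e X](add0r x); apply: hd => //.
  move: he => /andP[-> em]; apply: (lt_trans em); apply: le_lt_trans Nd.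
  by rewrite lef_pV2 ?posrE// ler_nat ltnS leq_maxr.
have [m0 [x0 [p p0 hp]]] := baire_ball cA covA.
move=> K cK.
(* a compact box inside the ball, so that the hypothesis on translations
   applies to it *)
pose B := [set y : Rn | forall j, `[x0 0 j - p / 2, x0 0 j + p / 2]%classic (y 0 j)].
have cB : compact B.
  apply: (@rV_compact R n (fun j => `[x0 0 j - p / 2, x0 0 j + p / 2]%classic)) => j.
  exact: segment_compact.
have cov := (compact_near_coveringP K).1 cK (nat * R)%type (filter_prod \oo 0^'+)
  (fun i y => normc (f i.2 y - f i.2 0) <= 2 * r i.1 i.2) _.
have : \forall i \near filter_prod \oo 0^'+,
  K `<=` (fun y => normc (f i.2 y - f i.2 0) <= 2 * r i.1 i.2).
  apply: cov => y0 Ky0.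
  have [m1 /at_right0P[d d0 hd]] := fr (y0 - x0) B cB.
  pose M := maxn m0 m1.
  exists ([set y | B (y - (y0 - x0))],
    [set i : nat * R | (M <= i.1)%N /\ (0 < i.2 < Num.min d m0.+1%:R^-1)]) => /=.
    split.
      apply/rV_nearP; exists (p / 2); first by rewrite divr_gt0.
      move=> y hy j /=; rewrite in_itv/=.
      have := hy j; rewrite ltr_distlC !mxE => /andP[h1 h2].
      by apply/andP; split; lra.
    exists ([set m | (M <= m)%N], [set e : R | 0 < e < Num.min d m0.+1%:R^-1]) => //=.
    split; first by exists M.
    by apply/at_right0P; exists (Num.min d m0.+1%:R^-1) => //;
      rewrite lt_min d0 invr_gt0 ltr0n.
  move=> [y [m e]] /= [By [Mm]]; rewrite lt_min => /and3P[e0 ed em0].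
  have em : 0 < e < m0.+1%:R^-1 by rewrite e0.
  have e1 := lt1 _ _ em.
  (* y is moved into the box by the translation y0 - x0 *)
  have -> : f e y - f e 0 = (f e ((y - (y0 - x0)) + (y0 - x0)) - f e
    (y - (y0 - x0))) + (f e (y - (y0 - x0)) - f e 0).
    by rewrite subrK addrA subrK.
  apply: (le_trans (le_normcD _ _)); rewrite mulr2n mulrDl mul1r; apply: lerD.
    apply: (@le_trans _ _ (r m1 e)); first by apply: hd => //; rewrite e0.
    by apply: rle => //; apply: leq_trans Mm; exact: leq_maxr.
  apply: (@le_trans _ _ (r m0 e)).
    apply: hp => // j; have := By j; rewrite /= in_itv/= !mxE => /andP[h1 h2].
    by rewrite ltr_distlC; apply/andP; split; lra.
  by apply: rle => //; apply: leq_trans Mm; exact: leq_maxl.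
move=> [[U V] /= [[N _ UN] Vn] UV].
exists N; apply: filterS Vn => e Ve y Ky.
by apply: (UV (N, e)) => //; split => //; apply: UN => /=; exact: leqnn.
Qed.

End translations.

(** * Smallness of nets *)

Section small_nets.
Context {R : realType} (n : nat) (s : ultra) (w : R -> R).
Hypothesis hw : weight w.
Local Notation Rn := 'rV[R]_n.
Local Notation supp chi := (closure [set x | chi x != 0%R]).
Implicit Types (f g : R -> Rn -> R[i]) (chi psi : Rn -> R[i]).

Lemma near_unit : \forall e \near (0 : R)^'+, 0 < e < 1.
Proof. by apply/at_right0P; exists 1. Qed.

(** The weight dominates a logarithm, so it tends to infinity. *)
Lemma weight_inv_large (A : R) : \forall e \near (0 : R)^'+, A <= w e^-1.
Proof.
have [w0 [_ [_ [_ [_ [_ wlim]]]]]] := hw.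
have [M [_ hM]] := (cvgryPge _).1 wlim (Num.max A 0).
pose T := Num.max M (expR 1).
have T0 : 0 < T by rewrite lt_max expR_gt0 orbT.
apply/at_right0P; exists T^-1 => [|e /andP[e0 eT]]; first by rewrite invr_gt0.
have Te : T < e^-1 by rewrite -[T]invrK ltf_pV2 ?posrE// invr_gt0.
have /andP[Me ee] : (M < e^-1) && (expR 1 < e^-1) by rewrite -gt_max.
have ei0 : 0 < e^-1 by rewrite invr_gt0.
have l1 : 1 <= ln (1 + e^-1).
  rewrite -[leLHS]expRK ler_ln ?posrE ?expR_gt0//; last by rewrite addr_gt0.
  by rewrite (le_trans (ltW ee))// lerDr.
have := hM _ Me; rewrite ler_pdivlMr; last by rewrite (lt_le_trans _ l1).
apply: le_trans; apply: (@le_trans _ _ (Num.max A 0)); first by rewrite le_max lexx.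
by rewrite ler_peMr// le_max lexx orbT.
Qed.

Lemma exp_weight_inv_large (A b : R) : 0 < b ->
  \forall e \near (0 : R)^'+, A <= expR (b * w e^-1).
Proof.
move=> b0; apply: filterS (weight_inv_large (A / b)) => e.
rewrite ler_pdivrMr// mulrC => Ae.
by rewrite (le_trans _ (expR_ge1Dx _))// (le_trans Ae)// lerDr.
Qed.

Lemma local_norm_le_exp_sup g (K : set Rn) h k : 0 <= h -> ultranet s w g ->
  is_o (fun e => local_norm s w K h (g e)) (fun e => expR (k * w e^-1)) ->
  forall c, 0 < c -> \forall e \near (0 : R)^'+,
    forall x, K x -> normc (g e x) <= c * expR (k * w e^-1).
Proof.
move=> h0 ug og c c0.
have Cn0 : 0 < (2 * pi) ^+ n :> R by rewrite exprn_gt0// mulr_gt0// pi_gt0.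
have := og _ (mulr_gt0 Cn0 c0); move=> hg.
apply: filterS2 near_unit hg => e e1 he x Kx.
have := le_trans (sup_le_local_norm hw (ug e e1) h0 Kx) he.
by rewrite lee_fin -mulrA ler_pM2l.
Qed.

(** A seminorm that is finite for one eps is an infimum over a nonempty set. *)
Lemma moderate_cutoff f (K : set Rn) : moderate s w f -> compact K ->
  exists2 chi, testfun s w chi & forall x, K x -> chi x = 1.
Proof.
move=> [uf mf] cK.
have [h [k og]] : exists h k, is_o (fun e => local_norm s w K h (f e))
  (fun e => expR (k * w e^-1)).
  have := mf K cK; case: (s) => /(_ 1 ltr01) [k k0 hk]; first by exists 1, k.
  by exists k, 1.
have [e he] := @filter_ex _ (0 : R)^'+ _ _ (og 1 ltr01).
have : (local_norm s w K h (f e) < +oo)%E by apply: le_lt_trans he (ltry _).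
by move=> /ereal_inf_lt[_ [psi [tpsi psi1] _] _]; exists psi.
Qed.

Lemma le_local_norm (K : set Rn) k l (g : Rn -> R[i]) : ultrasmooth s w g -> k <= l ->
  (local_norm s w K k g <= local_norm s w K l g)%E.
Proof.
move=> [_ tg] kl; apply: le_ereal_inf_tmp => _ [psi [tpsi psi1] <-].
apply: ge_ereal_inf; exists (wnorm w k (fun x => psi x * g x)); first by exists psi.
exact: (le_wnorm hw (testfun_Cc (tg _ tpsi)).1 kl).
Qed.

(** The square root halves the exponent k2, and moderateness costs k1; the slack b
    absorbs the constants. *)
Lemma interpolated_smallness f (c : R -> R[i]) (K : set Rn) chi (h a b k k1 k2 : R) :
  ultranet s w f -> 0 <= h -> 0 < a -> testfun s w chi ->
    (forall x, K x -> chi x = 1) ->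
  (wnorm w (2 * h + a) chi < +oo)%E -> 0 <= k1 -> 0 < b -> k1 + k + b <= k2 / 2 ->
  is_o (fun e => local_norm s w (supp chi) (2 * h + a) (f e))
    (fun e => expR (k1 * w e^-1)) ->
  (\forall e \near (0 : R)^'+, normc (c e) <= expR (k1 * w e^-1)) ->
  (\forall e \near (0 : R)^'+, forall x, supp chi x ->
     normc (f e x - c e) <= 2 * expR (- (k2 * w e^-1))) ->
  is_o (fun e => local_norm s w K h (fun x => f e x - c e))
    (fun e => expR (- (k * w e^-1))).
Proof.
move=> uf h0 a0 tchi chi1 chil k10 b0 kk of1 ofc ofs d d0.
have [A A0 hA] := local_norm_subr_cst_le hw h0 a0 tchi chi1 chil.
have of1' := of1 1 ltr01.
near=> e.
have e1 : 0 < e < 1 by near: e; exact: near_unit.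
have large : 6 * A / d <= expR (b * w e^-1) by near: e; exact: exp_weight_inv_large.
have w0 : 0 <= w e^-1 by near: e; exact: weight_inv_large.
have hs : forall x, supp chi x -> normc (f e x - c e) <= 2 * expR (- (k2 * w e^-1))
  by near: e.
have hm : (local_norm s w (supp chi) (2 * h + a) (f e) <= (expR (k1 * w e^-1))%:E)%E.
  have : (local_norm s w (supp chi) (2 * h + a) (f e) <=
    (1 * expR (k1 * w e^-1))%:E)%E by near: e.
  by rewrite mul1r.
have hc : normc (c e) <= expR (k1 * w e^-1) by near: e.
set v := w e^-1 in large w0 hs hm hc *.
have D0 : 0 <= 2 * expR (- (k2 * v)) by rewrite mulr_ge0// expR_ge0.
have M0 : 0 <= expR (k1 * v) by exact: expR_ge0.
apply: (le_trans (hA _ _ _ _ (uf e e1) D0 M0 hs hm)); rewrite lee_fin.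
(* sqrt 2 <= 2 and 1 + M + |c| <= 3 M, whence the constant 6 = 2 * 3 *)
have sq : Num.sqrt (2 * expR (- (k2 * v))) <= 2 * expR (- (k2 / 2 * v)).
  rewrite -[leRHS]ger0_norm; last by rewrite mulr_ge0// expR_ge0.
  rewrite -sqrtr_sqr ler_wsqrtr// exprMn -expRM_natl.
  rewrite (_ : 2 * - (k2 / 2 * v) = - (k2 * v)); last by field.
  by rewrite ler_wpM2r ?expR_ge0// expr2; lra.
have m1 : 1 + expR (k1 * v) + normc (c e) <= 3 * expR (k1 * v).
  have : 1 <= expR (k1 * v) by rewrite -expR0 ler_expR mulr_ge0.
  lra.
apply: (@le_trans _ _ (A * (2 * expR (- (k2 / 2 * v))) * (3 * expR (k1 * v)))).
  by apply: ler_pM => //; rewrite ?mulr_ge0 ?sqrtr_ge0 ?addr_ge0 ?normc_ge0//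
    ler_wpM2l.
have ek : expR (- (k2 / 2 * v)) * expR (k1 * v) * expR (b * v) <= expR (- (k * v)).
  rewrite -!expRD ler_expR.
  have : (k1 + k + b) * v <= k2 / 2 * v by rewrite ler_wpM2r.
  lra.
have v0 := expR_gt0 (b * v).
rewrite (_ : A * _ * _ = 6 * A * (expR (- (k2 / 2 * v)) * expR (k1 * v)));
  last by ring.
apply: (@le_trans _ _ (d * expR (b * v) * (expR (- (k2 / 2 * v)) * expR (k1 * v)))).
  rewrite ler_wpM2r ?mulr_ge0 ?expR_ge0//.
  by rewrite [d * _]mulrC -ler_pdivrMr.
rewrite -mulrA ler_pM2l// mulrC; exact: ek.
Unshelve. all: by end_near. Qed.

Lemma negligible_translate_sup f (x : Rn) (K : set Rn) : compact K ->
  eq_gen s w (fun e y => translate x f e y - f e y) (fun _ _ => 0) ->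
  match s with
  | Beurling => forall k, 0 < k -> \forall e \near (0 : R)^'+,
      forall y, K y -> normc (f e (y + x) - f e y) <= expR (- (k * w e^-1))
  | Roumieu => exists2 k, 0 < k & \forall e \near (0 : R)^'+,
      forall y, K y -> normc (f e (y + x) - f e y) <= expR (- (k * w e^-1))
  end.
Proof.
move=> cK [ung neg].
have key h k : 0 < h -> is_o (fun e =>
  local_norm s w K h (fun y => translate x f e y - f e y - 0))
    (fun e => expR (- (k * w e^-1))) ->
  \forall e \near (0 : R)^'+, forall y, K y ->
    normc (f e (y + x) - f e y) <= expR (- (k * w e^-1)).
  move=> h0 o1.
  have o2 : is_o (fun e => local_norm s w K h
    (fun y => translate x f e y - f e y - 0))
    (fun e => expR (- k * w e^-1)) by under [X in is_o _ X]eq_fun do rewrite mulNr.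
  have := local_norm_le_exp_sup (ltW h0) ung o2 ltr01.
  apply: filterS => e he y Ky; have := he y Ky.
  by rewrite subr0 mul1r mulNr.
have := neg K cK; case: (s) key => key /=.
  by move=> hh k k0; apply: (key 1) => //; exact: hh.
by move=> [k k0 [h h0 hh]]; exists k => //; exact: (key h).
Qed.

Lemma moderate_ccontinuous f e : moderate s w f -> 0 < e < 1 -> ccontinuous (f e).
Proof.
move=> [uf _] /uf [sf _]; have := sf 0%N.
by move=> /= [[c1 _] [c2 _]].
Qed.

End small_nets.

(** * Invariant nets are constant *)

Section invariant_nets.
Context {R : realType} (n : nat) (w : R -> R).
Hypothesis hw : weight w.
Local Notation Rn := 'rV[R]_n.
Local Notation supp chi := (closure [set x | chi x != 0%R]).
Implicit Types (f : R -> Rn -> R[i]).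

Lemma moderate_number_value s f : moderate s w f ->
  moderate_number s w (fun e => f e 0).
Proof.
move=> [uf mf].
have := mf [set 0] (@compact_set1 _ _).
have key h k : 0 < h -> is_o (fun e => local_norm s w [set 0] h (f e))
  (fun e => expR (k * w e^-1)) ->
  is_o (fun e => (normc (f e 0))%:E) (fun e => expR (k * w e^-1)).
  move=> h0 o1 c c0; have := local_norm_le_exp_sup hw (ltW h0) uf o1 c0.
  by apply: filterS => e he; rewrite lee_fin; exact: he.
case: (s) key => key /= h.
  by have [k k0 hk] := h 1 ltr01; exists k => //; exact: (key 1).
by move=> k k0; have [l l0 hl] := h k k0; exact: (key l).
Qed.

(** Here the sup estimate is available with any exponent, so it is requested large
    enough to beat the moderateness exponents of the net and of its values. *)
Lemma invariant_Beurling f : moderate Beurling w f ->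
  (forall x : Rn, eq_gen Beurling w (fun e y => translate x f e y - f e y)
    (fun _ _ => 0)) ->
  eq_gen Beurling w f (constant_net (fun e => f e 0)).
Proof.
move=> mf inv; have [uf mfK] := mf.
split=> [e e1|K cK small h h0 k k0];
  first exact: (ultrasmooth_subr_cst hw (f e 0) (uf e e1)).
have [chi tchi chi1] := moderate_cutoff mf cK.
have cS : compact (supp chi) by have [_ [cs _]] := tchi.
have l0 : 0 < 2 * h + 1 by rewrite addr_gt0// mulr_gt0.
have [k1 k10 o1] := mfK _ cS _ l0.
have [k2 k20 o2] := moderate_number_value mf.
pose k3 := Num.max k1 k2.
have k30 : 0 <= k3 by rewrite le_max (ltW k10).
(* the square root halves k4, and 1 is the slack *)
pose k4 := 2 * (k3 + k + 1).
have k40 : 0 < k4 by rewrite mulr_gt0// ltr_wpDl// addr_ge0// ltW.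
have [m hm] := translation_invariant_sup (r := fun _ e => expR (- (k4 * w e^-1)))
  (fun e e1 => moderate_ccontinuous mf e1) (fun _ _ _ _ _ => lexx _)
  (fun x K0 cK0 => ex_intro _ 0%N (negligible_translate_sup hw cK0 (inv x) k4 k40))
    cS.
have w0 e : 0 < e < 1 -> 0 <= w e^-1.
  by move=> /andP[e0 _]; apply: hw.1; rewrite invr_ge0 ltW.
apply: (@interpolated_smallness _ _ Beurling _ hw f (fun e => f e 0) K chi h 1 1 k
  k3 k4) => //.
- exact: ltW.
- have [_ [_ tl]] := tchi; exact: tl.
- by rewrite (_ : k4 / 2 = k3 + k + 1)// /k4; field.
- move=> c c0; apply: filterS2 near_unit (o1 c c0) => e e1 he; apply: (le_trans he).
  rewrite lee_fin ler_wpM2l ?(ltW c0)// ler_expR ler_wpM2r ?w0//.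
  by rewrite le_max lexx.
- apply: filterS2 near_unit (o2 1 ltr01) => e e1; rewrite lee_fin mul1r => he;
    apply: (le_trans he).
  by rewrite ler_expR ler_wpM2r ?w0// le_max lexx orbT.
Qed.

(** Here moderateness holds with arbitrarily small exponents, so these are chosen
    after, and small with respect to, the exponent of the sup estimate; the price
    is a smaller l in the seminorm. *)
Lemma invariant_Roumieu f : moderate Roumieu w f ->
  (forall x : Rn, eq_gen Roumieu w (fun e y => translate x f e y - f e y)
    (fun _ _ => 0)) ->
  eq_gen Roumieu w f (constant_net (fun e => f e 0)).
Proof.
move=> mf inv; have [uf mfK] := mf.
split=> [e e1|K cK small]; first exact: (ultrasmooth_subr_cst hw (f e 0) (uf e e1)).
have [chi tchi chi1] := moderate_cutoff mf cK.
have cS : compact (supp chi) by have [_ [cs _]] := tchi.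
have w0 e : 0 < e < 1 -> 0 <= w e^-1.
  by move=> /andP[e0 _]; apply: hw.1; rewrite invr_ge0 ltW.
have [m hm] : exists m, \forall e \near (0 : R)^'+, forall y, supp chi y ->
    normc (f e y - f e 0) <= 2 * expR (- (m.+1%:R^-1 * w e^-1)).
  apply: (translation_invariant_sup (r := fun m e =>
    expR (- (m.+1%:R^-1 * w e^-1)))) => //.
  - by move=> e e1; exact: (moderate_ccontinuous mf e1).
  - move=> e m m' e1 mm'; rewrite ler_expR lerN2 ler_wpM2r ?w0//.
    by rewrite lef_pV2 ?posrE// ler_nat ltnS.
  - move=> x K0 cK0; have [k k0 hk] := negligible_translate_sup hw cK0 (inv x).
    have [N _ /(_ N (leqnn N)) /= Nk] := near_infty_natSinv_lt (PosNum k0).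
    exists N; apply: filterS2 near_unit hk => e e1 he y Ky;
      apply: (le_trans (he y Ky)).
    by rewrite ler_expR lerN2 ler_wpM2r ?w0// ltW.
have [h0 h00 chil] := tchi.2.2.
(* three exponents q have to fit below half of 1/(m+1) *)
pose q : R := m.+1%:R^-1 / 8.
have q0 : 0 < q by rewrite divr_gt0// invr_gt0.
have [h1 h10 o1] := mfK _ cS _ q0.
have o2 : is_o (fun e => (normc (f e 0))%:E) (fun e => expR (q * w e^-1)) by exact:
  (moderate_number_value mf).
pose l := Num.min h0 h1.
have l0 : 0 < l by rewrite lt_min h00.
(* interpolation at h = l/4 and a = l/2 uses exactly the exponent l *)
have ll : 2 * (l / 4) + l / 2 = l by field.
exists q => //; exists (l / 4); first by rewrite divr_gt0.
have h40 : 0 <= l / 4 by rewrite divr_ge0// ltW.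
have l20 : 0 < l / 2 by rewrite divr_gt0.
have chil' : (wnorm w (2 * (l / 4) + l / 2) chi < +oo)%E.
  rewrite ll; apply: le_lt_trans chil; apply: (le_wnorm hw (testfun_Cc tchi).1).
  by rewrite ge_min lexx.
have sum : q + q + q <= m.+1%:R^-1 / 2.
  have : 0 < m.+1%:R^-1 :> R by rewrite invr_gt0.
  by rewrite /q; move: (m.+1%:R^-1) => p p0; lra.
apply: (@interpolated_smallness _ _ Roumieu _ hw f (fun e => f e 0) K chi (l / 4)
  (l / 2) q q q m.+1%:R^-1
  uf h40 l20 tchi chi1 chil' (ltW q0) q0 sum).
- rewrite ll => c c0; apply: filterS2 near_unit (o1 c c0) => e e1 he;
    apply: le_trans he.
  by apply: (le_local_norm hw _ (uf e e1)); rewrite ge_min lexx orbT.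
- by apply: filterS (o2 1 ltr01) => e; rewrite lee_fin mul1r.
- exact: hm.
Qed.

End invariant_nets.

Theorem theorem8p1 (R : realType) (n : nat) (s : ultra) (w : R -> R)
    (f : R -> 'rV[R]_n -> R[i]) :
  weight w ->
  moderate s w f ->
  (forall x : 'rV[R]_n,
    eq_gen s w (fun eps y => translate x f eps y - f eps y) (fun _ _ => 0)) ->
  exists c : R -> R[i],
    moderate_number s w c /\ eq_gen s w f (constant_net c).
Proof.
move=> hw mf inv; exists (fun e => f e 0); split; first exact: moderate_number_value.
by case: s mf inv => mf inv; [exact: invariant_Beurling|exact: invariant_Roumieu].
Qed.
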